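(* Let $m\ge2$, $G=\mathbb Z/m\mathbb Z$ with generator $s$, let $\lambda$ be a primitive $m$-th root of unity, $c_1,\dots,c_{m-1}\in\mathbb C$, and let $H_{1,c}$ be the algebra generated by $x,y,s$ with relations $s^m=1$, $sxs^{-1}=\lambda x$, $sys^{-1}=\lambda^{-1}y$, $[y,x]=1-2\sum_{j=1}^{m-1}c_js^j$. Set $$b_n=2\sum_{j=1}^{m-1}\frac{1-\lambda^{jn}}{1-\lambda^j}c_j .$$ Let $M_c(\mathbb C)=\mathbb C[x]$ be the standard module with trivial lowest weight, and $L_c(\mathbb C)$ its irreducible quotient. Then: (i) $M_c(\mathbb C)$ is irreducible if and only if $n-b_n\ne0$ for every integer $n\ge1$. (ii) Assume that $r$ is the smallest positive integer such that $r=b_r$. Then $L_c(\mathbb C)$ has dimension $r$ (which can be any number not divisible by $m$), with basis $1,x,\dots,x^{r-1}$.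
   Context: $M_c(\mathbb C)=H_{1,c}\otimes_{\mathbb CG\ltimes\mathbb C[y]}\mathbb C$, where $y$ acts on $\mathbb C$ by $0$ and $G$ acts trivially; as a vector space it is $\mathbb C[x]$. $L_c(\mathbb C)$ is the quotient of $M_c(\mathbb C)$ by its maximal proper submodule. The parenthetical in (ii) means: as $c$ varies, the values of $r$ that occur are exactly the positive integers not divisible by $m$. *)

(* Defs.v *)
From HB Require Import structures.
From mathcomp Require Import all_boot all_order all_algebra.
From mathcomp Require Import finmap boolp reals complex monalg.

Set Implicit Arguments.
Unset Strict Implicit.
Unset Printing Implicit Defensive.

Import Order.TTheory GRing.Theory Num.Theory.
Local Open Scope ring_scope.
Local Open Scope quotient_scope.

(* Conventions. Rings may be noncommutative, modules are left modules, and    *)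
(* subsets are Boolean predicates (classically, every Prop-valued predicate   *)
(* is one, through the asbool brackets `[< >]).                               *)
(* Lalgebra/Algebra of MathComp require 1 != 0, which is not known a priori   *)
(* for an algebra given by generators and relations; such an algebra over K   *)
(* is therefore a pzRingType with a ring morphism from K with central values. *)

Section TwoSidedIdeals.
Variable A : pzRingType.

Definition two_sided_ideal (I : {pred A}) :=
  [/\ zmod_closed I, (forall a u, u \in I -> a * u \in I)
    & (forall a u, u \in I -> u * a \in I)].

Definition ideal_gen (S : seq A) : {pred A} :=
  fun a => `[< forall I : {pred A},
                 two_sided_ideal I -> {subset S <= I} -> a \in I >].

Lemma ideal_genP S a : reflect
  (forall I : {pred A}, two_sided_ideal I -> {subset S <= I} -> a \in I)
  (a \in ideal_gen S).
Proof. exact: asboolP. Qed.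

Lemma ideal_gen_ideal S : two_sided_ideal (ideal_gen S).
Proof.
split; first split.
- by apply/ideal_genP=> I [[I0 _] _ _].
- move=> u v /ideal_genP uI /ideal_genP vI; apply/ideal_genP=> I Iid sSI.
  by have [[_ IB] _ _] := Iid; apply: IB; [apply: uI|apply: vI].
- move=> a u /ideal_genP uI; apply/ideal_genP=> I Iid sSI.
  by have [_ Il _] := Iid; apply: Il; apply: uI.
- move=> a u /ideal_genP uI; apply/ideal_genP=> I Iid sSI.
  by have [_ _ Ir] := Iid; apply: Ir; apply: uI.
Qed.

Lemma sub_ideal_gen S : {subset S <= ideal_gen S}.
Proof. by move=> a aS; apply/ideal_genP=> I _; apply. Qed.

Lemma ideal_gen_zmod S : zmod_closed (ideal_gen S).
Proof. by case: (ideal_gen_ideal S). Qed.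

HB.instance Definition _ S :=
  GRing.isZmodClosed.Build A (ideal_gen S) (ideal_gen_zmod S).

End TwoSidedIdeals.

Section QuotientRing.
Variables (A : pzRingType) (S : seq A).

Definition quot_ring : Type := Quotient.quot (ideal_gen S).
HB.instance Definition _ := GRing.Zmodule.on quot_ring.

Definition qpi (a : A) : quot_ring := \pi_(Quotient.quot (ideal_gen S)) a.

Lemma qpi_eqE a b : qpi a = qpi b <-> a - b \in ideal_gen S.
Proof. by rewrite Quotient.idealrBE; split=> /eqP. Qed.

Lemma qpi_ind (P : quot_ring -> Prop) : (forall a, P (qpi a)) -> forall u, P u.
Proof. by move=> Pq u; rewrite -[u]reprK; apply: Pq. Qed.

Lemma qpi_zmod_morphism : zmod_morphism qpi.
Proof.
by move=> a b; rewrite /qpi !piE.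
Qed.
HB.instance Definition _ :=
  GRing.isZmodMorphism.Build A quot_ring qpi qpi_zmod_morphism.

Definition qmul (u v : quot_ring) : quot_ring :=
  qpi (repr (u : Quotient.quot (ideal_gen S)) *
       repr (v : Quotient.quot (ideal_gen S))).

Lemma repr_qpi a : qpi (repr (qpi a : Quotient.quot (ideal_gen S))) = qpi a.
Proof. exact: reprK. Qed.

Lemma qpiM a b : qmul (qpi a) (qpi b) = qpi (a * b).
Proof.
rewrite /qmul; apply/qpi_eqE; have [_ Il Ir] := ideal_gen_ideal S.
set a' := repr _; set b' := repr _.
rewrite -[_ - _](subrKA (a' * b)) -mulrBr -mulrBl.
by apply: rpredD; [apply: Il|apply: Ir]; apply/qpi_eqE/repr_qpi.
Qed.

Lemma qmulA : associative qmul.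
Proof.
by elim/qpi_ind=> a; elim/qpi_ind=> b; elim/qpi_ind=> c; rewrite !qpiM mulrA.
Qed.
Lemma qmul1 : left_id (qpi 1) qmul.
Proof. by elim/qpi_ind=> a; rewrite qpiM mul1r. Qed.
Lemma qmulr1 : right_id (qpi 1) qmul.
Proof. by elim/qpi_ind=> a; rewrite qpiM mulr1. Qed.
Lemma qmulDl : left_distributive qmul +%R.
Proof.
elim/qpi_ind=> a; elim/qpi_ind=> b; elim/qpi_ind=> c.
by rewrite -raddfD !qpiM mulrDl raddfD.
Qed.
Lemma qmulDr : right_distributive qmul +%R.
Proof.
elim/qpi_ind=> a; elim/qpi_ind=> b; elim/qpi_ind=> c.
by rewrite -raddfD !qpiM mulrDr raddfD.
Qed.

HB.instance Definition _ := GRing.Zmodule_isPzRing.Build quot_ring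
  qmulA qmul1 qmulr1 qmulDl qmulDr.

Lemma qpi_monoid_morphism : monoid_morphism qpi.
Proof. by split=> // a b; rewrite -qpiM. Qed.
HB.instance Definition _ :=
  GRing.isMonoidMorphism.Build A quot_ring qpi qpi_monoid_morphism.

End QuotientRing.
Arguments qpi {A S} a.

Section QuotientRingLift.
Variables (A B : pzRingType) (S : seq A) (f : {rmorphism A -> B}).
Hypothesis fS : forall a, a \in S -> f a = 0.

Definition qlift (_ : forall a, a \in S -> f a = 0) (u : quot_ring S) : B :=
  f (repr (u : Quotient.quot (ideal_gen S))).

Lemma qlift_pi a : qlift fS (qpi a) = f a.
Proof.
apply/eqP; rewrite -subr_eq0 -raddfB; set b := _ - _.
pose I : {pred A} := fun a => f a == 0.
have IE c : (c \in I) = (f c == 0) by [].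
rewrite -IE; have /ideal_genP : b \in ideal_gen S.
  by apply/qpi_eqE; apply: repr_qpi.
move=> /(_ I); apply=> [|c /fS fc0]; last by rewrite IE fc0.
split; first split=> [|u v].
- by rewrite IE raddf0.
- by rewrite !IE rmorphB => /eqP-> /eqP->; rewrite subr0.
- by move=> c u; rewrite !IE rmorphM => /eqP->; rewrite mulr0.
- by move=> c u; rewrite !IE rmorphM => /eqP->; rewrite mul0r.
Qed.

Lemma qlift_zmod_morphism : zmod_morphism (qlift fS).
Proof.
by elim/qpi_ind=> a; elim/qpi_ind=> b; rewrite -raddfB !qlift_pi raddfB.
Qed.
Lemma qlift_monoid_morphism : monoid_morphism (qlift fS).
Proof.
split; first by rewrite -(rmorph1 (@qpi A S)) qlift_pi rmorph1.
by elim/qpi_ind=> a; elim/qpi_ind=> b; rewrite -rmorphM !qlift_pi rmorphM.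
Qed.
HB.instance Definition _ :=
  GRing.isZmodMorphism.Build (quot_ring S) B (qlift fS) qlift_zmod_morphism.
HB.instance Definition _ :=
  GRing.isMonoidMorphism.Build (quot_ring S) B (qlift fS) qlift_monoid_morphism.

End QuotientRingLift.

(* The free algebra K<X_0, ..., X_(n-1)>: the algebra of the free monoid. *)
Definition free_alg (K : fieldType) (n : nat) := {malg K[{fmonom 'I_n}]}.
HB.instance Definition _ K n := GRing.Lalgebra.on (free_alg K n).

Definition gen (K : fieldType) n (i : 'I_n) : free_alg K n := << fmu i >>.
Arguments gen {K n} i.

Section FreeEval.
Variables (K : fieldType) (n : nat) (A : nzRingType).
Variables (f : {rmorphism K -> A}) (g : 'I_n -> A).
Hypothesis f_central : forall k a, GRing.comm (f k) a.

Definition word_eval (w : {fmonom 'I_n}) : A := \prod_(i <- (w : seq 'I_n)) g i.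

Lemma word_eval_mmorphism : mmorphism word_eval.
Proof.
by split=> [u v|]; rewrite /word_eval /= ?fmM ?big_cat // fm1 big_nil.
Qed.
HB.instance Definition _ :=
  isMultiplicative.Build {fmonom 'I_n} A word_eval word_eval_mmorphism.

Definition free_eval (_ : forall k a, GRing.comm (f k) a)
  (u : free_alg K n) : A := mmap f word_eval u.

Lemma free_eval_zmod_morphism : zmod_morphism (free_eval f_central).
Proof. exact: mmap_is_additive. Qed.
Lemma free_eval_monoid_morphism : monoid_morphism (free_eval f_central).
Proof.
have [fM f1]: multiplicative (mmap f word_eval).
  by apply: commr_mmap_is_multiplicative=> *; apply: f_central.
by split.
Qed.
HB.instance Definition _ := GRing.isZmodMorphism.Build
  (free_alg K n) A (free_eval f_central) free_eval_zmod_morphism.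
HB.instance Definition _ := GRing.isMonoidMorphism.Build
  (free_alg K n) A (free_eval f_central) free_eval_monoid_morphism.

Lemma free_eval_gen i : free_eval f_central (gen i) = g i.
Proof.
by rewrite /free_eval /gen mmapU /= rmorph1 mul1r /word_eval fmU big_seq1.
Qed.

Lemma free_evalZ k u :
  free_eval f_central (k *: u) = f k * free_eval f_central u.
Proof. exact: mmapZ. Qed.

End FreeEval.

Section FreeConst.
Variables (K : fieldType) (n : nat).

Definition free_const (k : K) : free_alg K n := k%:MP.
Lemma free_const_zmod_morphism : zmod_morphism free_const.
Proof. exact: raddfB. Qed.
Lemma free_const_monoid_morphism : monoid_morphism free_const.
Proof. by split=> [|k l]; [exact: rmorph1|exact: rmorphM]. Qed.
HB.instance Definition _ := GRing.isZmodMorphism.Build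
  K (free_alg K n) free_const free_const_zmod_morphism.
HB.instance Definition _ := GRing.isMonoidMorphism.Build
  K (free_alg K n) free_const free_const_monoid_morphism.

Lemma free_const_central k u : GRing.comm (free_const k) u.
Proof.
rewrite /GRing.comm /free_const [u in RHS]monalgE [u in LHS]monalgE.
rewrite mulr_sumr mulr_suml; apply: eq_bigr=> w _.
by rewrite !malgM_def !fgmulUU mul1m mulm1 mulrC.
Qed.

End FreeConst.

Section PresentedAlgebra.
Variables (K : fieldType) (n : nat) (rels : seq (free_alg K n)).

Definition pres_alg := quot_ring rels.
HB.instance Definition _ := GRing.PzRing.on pres_alg.

Definition scal (k : K) : pres_alg := qpi (free_const n k).

Lemma scal_zmod_morphism : zmod_morphism scal.
Proof. by move=> k l; rewrite /scal !raddfB. Qed.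
Lemma scal_monoid_morphism : monoid_morphism scal.
Proof. by split=> [|k l]; rewrite /scal ?rmorphM // !rmorph1. Qed.
HB.instance Definition _ :=
  GRing.isZmodMorphism.Build K pres_alg scal scal_zmod_morphism.
HB.instance Definition _ :=
  GRing.isMonoidMorphism.Build K pres_alg scal scal_monoid_morphism.

End PresentedAlgebra.
Arguments scal {K n} rels k.


Lemma scal_central (K : fieldType) n (rels : seq (free_alg K n)) k u :
  scal rels k * u = u * scal rels k.
Proof.
elim/qpi_ind: u => a; rewrite /scal -!rmorphM; congr qpi.
exact: free_const_central.
Qed.

Section RestrictionOfScalars.
Variables (A B : pzRingType) (f : {rmorphism A -> B}) (V : lmodType B).

Definition restrict_scalars (_ : {rmorphism A -> B}) (W : lmodType B) : Type :=
  W.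

HB.instance Definition _ := GRing.Zmodule.on (restrict_scalars f V).

Definition restr_scale (a : A) (v : restrict_scalars f V) :
  restrict_scalars f V := f a *: (v : V).

Lemma restr_scaleA a b v :
  restr_scale a (restr_scale b v) = restr_scale (a * b) v.
Proof. by rewrite /restr_scale scalerA rmorphM. Qed.
Lemma restr_scale1 : left_id 1 restr_scale.
Proof. by move=> v; rewrite /restr_scale rmorph1 scale1r. Qed.
Lemma restr_scaleDr : right_distributive restr_scale +%R.
Proof. by move=> a u v; exact: scalerDr. Qed.
Lemma restr_scaleDl v : {morph restr_scale^~ v : a b / a + b}.
Proof. by move=> a b; rewrite /restr_scale rmorphD scalerDl. Qed.

HB.instance Definition _ := GRing.Zmodule_isLmodule.Build A
  (restrict_scalars f V) restr_scaleA restr_scale1 restr_scaleDr restr_scaleDl.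

End RestrictionOfScalars.

Section QuotientModule.
Variables (A : pzRingType) (V : lmodType A) (N : {pred V}).
Hypothesis subN : submod_closed N.

Definition submod_pred (_ : submod_closed N) : {pred V} := N.
HB.instance Definition _ := GRing.isZmodClosed.Build V (submod_pred subN)
  (GRing.submod_closedB subN).

Definition quot_mod : Type := Quotient.quot (submod_pred subN).
HB.instance Definition _ := GRing.Zmodule.on quot_mod.

Definition modpi (v : V) : quot_mod := \pi_(Quotient.quot (submod_pred subN)) v.

Lemma modpi_eqE u v : modpi u = modpi v <-> u - v \in N.
Proof.
rewrite -[_ \in N]/(_ \in submod_pred subN).
by rewrite Quotient.idealrBE; split=> /eqP.
Qed.

Lemma modpi_ind (P : quot_mod -> Prop) :
  (forall v, P (modpi v)) -> forall u, P u.
Proof. by move=> Pq u; rewrite -[u]reprK; apply: Pq. Qed.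

Lemma modpi_zmod_morphism : zmod_morphism modpi.
Proof. by move=> u v; rewrite /modpi !piE. Qed.
HB.instance Definition _ :=
  GRing.isZmodMorphism.Build V quot_mod modpi modpi_zmod_morphism.

Definition qscale (a : A) (u : quot_mod) : quot_mod :=
  modpi (a *: repr (u : Quotient.quot (submod_pred subN))).

Lemma qscale_modpi a v : qscale a (modpi v) = modpi (a *: v).
Proof.
apply/modpi_eqE; rewrite -scalerBr.
apply: (GRing.subsemimod_closedZ (GRing.submod_closed_semi subN)).
apply/modpi_eqE.
exact: (@reprK _ (Quotient.quot (submod_pred subN))).
Qed.

Lemma qscaleA a b v : qscale a (qscale b v) = qscale (a * b) v.
Proof. by elim/modpi_ind: v => v; rewrite !qscale_modpi scalerA. Qed.
Lemma qscale1 : left_id 1 qscale.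
Proof. by elim/modpi_ind=> v; rewrite qscale_modpi scale1r. Qed.
Lemma qscaleDr : right_distributive qscale +%R.
Proof.
move=> a; elim/modpi_ind=> u; elim/modpi_ind=> v.
by rewrite -raddfD !qscale_modpi scalerDr raddfD.
Qed.
Lemma qscaleDl v : {morph qscale^~ v : a b / a + b}.
Proof.
by elim/modpi_ind: v => v a b; rewrite !qscale_modpi scalerDl raddfD.
Qed.

HB.instance Definition _ := GRing.Zmodule_isLmodule.Build A quot_mod
  qscaleA qscale1 qscaleDr qscaleDl.

Lemma modpi_scalable : scalable modpi.
Proof. by move=> a v; rewrite -qscale_modpi. Qed.
HB.instance Definition _ :=
  GRing.isScalable.Build A V quot_mod *:%R modpi modpi_scalable.

End QuotientModule.
Arguments quot_mod {A V N} subN.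
Arguments modpi {A V N} subN v.

(* A (x)_B W, where A is a right B-module through f : the free abelian group  *)
(* on A * W modulo the subgroup generated by the usual relations; A acts by   *)
(* left multiplication on the first factor.                                   *)
Section InducedModule.
Variables (B A : pzRingType) (f : {rmorphism B -> A}) (W : lmodType B).

Let F := {malg int[(A * W)%type]}.

Variant tensor_rel : F -> Prop :=
| TensorDl a a' w :
    tensor_rel (<< (a + a', w) >> - (<< (a, w) >> + << (a', w) >>))
| TensorDr a w w' :
    tensor_rel (<< (a, w + w') >> - (<< (a, w) >> + << (a, w') >>))
| TensorBal a b w :
    tensor_rel (<< (a * f b, w) >> - << (a, b *: w) >>).

Definition tensor_null : {pred F} :=
  fun z => `[< forall N : {pred F},
                 zmod_closed N -> (forall u, tensor_rel u -> u \in N) ->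
                 z \in N >].

Lemma tensor_nullP z : reflect
  (forall N : {pred F},
     zmod_closed N -> (forall u, tensor_rel u -> u \in N) -> z \in N)
  (z \in tensor_null).
Proof. exact: asboolP. Qed.

Lemma tensor_null_zmod : zmod_closed tensor_null.
Proof.
split=> [|u v /tensor_nullP uN /tensor_nullP vN]; apply/tensor_nullP=> N zN rN.
  by case: zN.
by case: (zN) => _; apply; [apply: uN|apply: vN].
Qed.
HB.instance Definition _ :=
  GRing.isZmodClosed.Build F tensor_null tensor_null_zmod.

Lemma tensor_rel_null u : tensor_rel u -> u \in tensor_null.
Proof. by move=> ru; apply/tensor_nullP=> N _; apply. Qed.

Definition induced : Type := Quotient.quot tensor_null.
HB.instance Definition _ := GRing.Zmodule.on induced.

Definition tpi (z : F) : induced := \pi_(Quotient.quot tensor_null) z.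

Lemma tpi_eqE u v : tpi u = tpi v <-> u - v \in tensor_null.
Proof. by rewrite Quotient.idealrBE; split=> /eqP. Qed.

Lemma tpi_zmod_morphism : zmod_morphism tpi.
Proof. by move=> u v; rewrite /tpi !piE. Qed.
HB.instance Definition _ :=
  GRing.isZmodMorphism.Build F induced tpi tpi_zmod_morphism.

Definition tensor (a : A) (w : W) : induced := tpi << (a, w) >>.

Lemma tensorDl a a' w : tensor (a + a') w = tensor a w + tensor a' w.
Proof.
by rewrite /tensor -(raddfD tpi); apply/tpi_eqE/tensor_rel_null/TensorDl.
Qed.
Lemma tensorDr a w w' : tensor a (w + w') = tensor a w + tensor a w'.
Proof.
by rewrite /tensor -(raddfD tpi); apply/tpi_eqE/tensor_rel_null/TensorDr.
Qed.
Lemma tensor_bal a b w : tensor (a * f b) w = tensor a (b *: w).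
Proof. exact/tpi_eqE/tensor_rel_null/TensorBal. Qed.

Definition tact (a : A) (z : F) : F :=
  \sum_(k <- msupp z) << z@_k *g (a * k.1, k.2) >>.

Lemma tactEw a (d : {fset A * W}) z : (msupp z `<=` d)%fset ->
  tact a z = \sum_(k <- d) << z@_k *g (a * k.1, k.2) >>.
Proof.
move=> le; rewrite [LHS](big_fset_incl _ le) => //= k kd /mcoeff_outdom ->.
by rewrite monalgU0.
Qed.

Lemma tact_zmod_morphism a : zmod_morphism (tact a).
Proof.
move=> u v; pose d := (msupp u `|` msupp v)%fset.
rewrite !(@tactEw _ d) ?fsubsetUl ?fsubsetUr ?msuppB_le //.
by rewrite -sumrB; apply: eq_bigr=> k _; rewrite mcoeffB monalgUB.
Qed.
HB.instance Definition _ a :=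
  GRing.isZmodMorphism.Build F F (tact a) (tact_zmod_morphism a).

Lemma tactU a b w : tact a << (b, w) >> = << (a * b, w) >>.
Proof. by rewrite (tactEw _ msuppU_le) big_seq_fset1 mcoeffUU. Qed.

Lemma tact_null a z : z \in tensor_null -> tact a z \in tensor_null.
Proof.
move=> /tensor_nullP zN; pose N : {pred F} := fun u => tact a u \in tensor_null.
have NE u : (u \in N) = (tact a u \in tensor_null) by [].
rewrite -NE; apply: zN => [|u ru].
  split=> [|u v]; rewrite !NE; first by rewrite raddf0 rpred0.
  by rewrite raddfB; apply: rpredB.
rewrite NE; apply/tensor_rel_null; case: ru => [b b' w|b w w'|b c w].
- by rewrite raddfB raddfD /= !tactU mulrDr; apply: TensorDl.
- by rewrite raddfB raddfD /= !tactU; apply: TensorDr.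
- by rewrite raddfB /= !tactU mulrA; apply: TensorBal.
Qed.

Definition tscale (a : A) (u : induced) : induced :=
  tpi (tact a (repr (u : Quotient.quot tensor_null))).

Lemma tscale_tpi a z : tscale a (tpi z) = tpi (tact a z).
Proof.
apply/tpi_eqE; rewrite -raddfB /=; apply/tact_null/tpi_eqE.
exact: (@reprK _ (Quotient.quot tensor_null)).
Qed.

Lemma tscaleDr : right_distributive tscale +%R.
Proof.
move=> a u v; rewrite -[u]reprK -[v]reprK -/(tpi _) -/(tpi _) -raddfD.
by rewrite !tscale_tpi !raddfD.
Qed.

Lemma tscale_tensor a b w : tscale a (tensor b w) = tensor (a * b) w.
Proof. by rewrite tscale_tpi tactU. Qed.

(* Elements of A (x)_B W are finite sums of pure tensors up to sign. *)
Lemma induced_ind (P : induced -> Prop) :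
    (forall a w, P (tensor a w)) -> (forall u v, P u -> P v -> P (u - v)) ->
  forall u, P u.
Proof.
move=> Pt PB u; rewrite -[u]reprK -/(tpi _); set z := repr u.
have P0 : P 0 by rewrite -(subrr (tensor 0 0)); apply: PB.
have PN v : P v -> P (- v) by rewrite -sub0r; apply: PB.
have PD v v' : P v -> P v' -> P (v + v').
  by move=> Pv Pv'; rewrite -[v']opprK; apply: PB=> //; apply: PN.
rewrite [z]monalgE raddf_sum; elim/big_ind: _ => // -[a w] _.
have -> : << z@_(a, w) *g (a, w) >> = << (a, w) >> *~ z@_(a, w).
  by rewrite -{1}[z@_(a, w)]intz (raddfMz (mkmalgU (a, w))).
rewrite raddfMz /= -/(tensor a w); move: (z@_(a, w)) => c.
have PMn n : P (tensor a w *+ n).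
  by elim: n => [|n IHn]; rewrite ?mulr0n // mulrS; apply: PD.
by case: c => n; rewrite ?NegzE ?mulrNz -pmulrn; [|apply: PN]; apply: PMn.
Qed.

Lemma tscale_zmod_morphism a : zmod_morphism (tscale a).
Proof.
move=> u v; rewrite -[u]reprK -[v]reprK -!/(tpi _) -(raddfB tpi) !tscale_tpi.
by rewrite !raddfB.
Qed.

Lemma tscaleA a b u : tscale a (tscale b u) = tscale (a * b) u.
Proof.
elim/induced_ind: u => [c w|u v IHu IHv]; first by rewrite !tscale_tensor mulrA.
by rewrite !tscale_zmod_morphism IHu IHv.
Qed.
Lemma tscale1 : left_id 1 tscale.
Proof.
elim/induced_ind=> [c w|u v IHu IHv]; first by rewrite !tscale_tensor mul1r.
by rewrite !tscale_zmod_morphism IHu IHv.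
Qed.
Lemma tscaleDl u : {morph tscale^~ u : a b / a + b}.
Proof.
move=> a b; elim/induced_ind: u => [c w|u v IHu IHv].
  by rewrite !tscale_tensor mulrDl tensorDl.
by rewrite !tscale_zmod_morphism IHu IHv opprD addrACA.
Qed.

HB.instance Definition _ := GRing.Zmodule_isLmodule.Build A induced
  tscaleA tscale1 tscaleDr tscaleDl.

End InducedModule.

Section ModuleNotions.
Variables (A : pzRingType) (V : lmodType A).

Definition proper_submodule (N : {pred V}) :=
  submod_closed N /\ exists v, v \notin N.

Definition irreducible_module :=
  (exists v : V, v != 0) /\
  forall N : {pred V}, submod_closed N ->
    (forall v, v \in N -> v = 0) \/ (forall v, v \in N).

Definition largest_proper_submodule (J : {pred V}) :=
  proper_submodule J /\ forall N, proper_submodule N -> {subset N <= J}.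

(* The sum of all proper submodules, as the smallest submodule containing     *)
(* them; it is the maximal proper submodule as soon as V has a largest one.   *)
Definition max_submodule : {pred V} :=
  fun v => `[< forall P : {pred V}, submod_closed P ->
                 (forall N, proper_submodule N -> {subset N <= P}) ->
                 v \in P >].

Lemma max_submoduleP v : reflect
  (forall P : {pred V}, submod_closed P ->
     (forall N, proper_submodule N -> {subset N <= P}) -> v \in P)
  (v \in max_submodule).
Proof. exact: asboolP. Qed.

Lemma max_submodule_closed : submod_closed max_submodule.
Proof.
split=> [|a u v /max_submoduleP uJ /max_submoduleP vJ];
  apply/max_submoduleP=> P subP sNP; first by case: subP.
by case: (subP) => _; apply; [apply: uJ|apply: vJ].
Qed.

Lemma sub_max_submodule N : proper_submodule N -> {subset N <= max_submodule}.
Proof. by move=> prN v vN; apply/max_submoduleP=> P _ sP; exact: sP vN. Qed.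

Lemma largest_max_submodule J :
  largest_proper_submodule J -> J =i max_submodule.
Proof.
move=> [prJ maxJ] v; apply/idP/idP; first exact: sub_max_submodule.
by move=> /max_submoduleP; apply=> //; case: prJ.
Qed.

Lemma max_submodule_largest : (exists v, v \notin max_submodule) ->
  largest_proper_submodule max_submodule.
Proof.
by move=> exv; split; [split=> //; exact: max_submodule_closed|
                       exact: sub_max_submodule].
Qed.

Definition irr_quotient : lmodType A := quot_mod max_submodule_closed.

End ModuleNotions.

Section Dimension.
Variables (K : fieldType) (V : lmodType K) (n : nat).

Definition is_basis (e : 'I_n -> V) :=
  forall v, exists! a : 'rV[K]_n, v = \sum_(i < n) a 0 i *: e i.

Definition has_dim := inhabited (Vector.axiom n V).

End Dimension.
Arguments has_dim {K} V n.

Section RationalCherednikCyclic.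
Variables (K : fieldType) (m : nat) (lam : K) (c : nat -> K).

Section Relations.
Variables (n : nat) (x y s : free_alg K n).

(* In view of s^m = 1, the inverse of s is written s^(m - 1). *)
Let s_inv := s ^+ m.-1.

Definition rel_sm := s ^+ m - 1.
Definition rel_sx := s * x * s_inv - lam *: x.
Definition rel_sy := s * y * s_inv - lam^-1 *: y.
Definition rel_yx :=
  y * x - x * y - (1 - 2%:R *: \sum_(1 <= j < m) c j *: s ^+ j).

End Relations.

(* x, y, s are the generators number 0, 1, 2. *)
Definition cherednik_rels : seq (free_alg K 3) :=
  let x := gen 0 in let y := gen 1 in let s := gen 2 in
  [:: rel_sm s; rel_sx x s; rel_sy y s; rel_yx x y s].

Definition cherednik : pzRingType := pres_alg cherednik_rels.
Definition cherednik_x : cherednik := qpi (gen 0).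
Definition cherednik_y : cherednik := qpi (gen 1).
Definition cherednik_s : cherednik := qpi (gen 2).

(* The semidirect product of the group algebra of G = Z/m and K[y], by       *)
(* generators and relations; y, s are the generators number 0, 1.             *)
Definition smash_rels : seq (free_alg K 2) :=
  let y := gen 0 in let s := gen 1 in [:: rel_sm s; rel_sy y s].

Definition smash : pzRingType := pres_alg smash_rels.
Definition smash_y : smash := qpi (gen 0).
Definition smash_s : smash := qpi (gen 1).

Definition smash_img (i : 'I_2) : free_alg K 3 :=
  if i == 0 then gen 1 else gen 2.

Definition free_smash_to_cherednik : {rmorphism free_alg K 2 -> cherednik} :=
  @qpi _ cherednik_rels \o free_eval smash_img (@free_const_central K 3).

Lemma free_smash_to_cherednik_rels u :
  u \in smash_rels -> free_smash_to_cherednik u = 0.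
Proof.
have qpi0 v : v \in cherednik_rels -> (qpi v : cherednik) = 0.
  move=> vR; rewrite -(raddf0 (@qpi _ cherednik_rels)); apply/qpi_eqE.
  by rewrite subr0; apply: sub_ideal_gen.
rewrite !inE => /orP[] /eqP-> /=.
  rewrite /rel_sm rmorphB rmorphXn rmorph1 /= free_eval_gen /=.
  by apply: (qpi0 (rel_sm (gen 2))); exact: mem_head.
rewrite /rel_sy rmorphB !rmorphM rmorphXn /= free_evalZ !free_eval_gen /=.
rewrite /free_const mul_malgC.
apply: (qpi0 (rel_sy (gen 1) (gen 2))).
exact: (@mem_nth _ 0 cherednik_rels 2 isT).
Qed.

Definition smash_to_cherednik : {rmorphism smash -> cherednik} :=
  qlift free_smash_to_cherednik_rels.

(* The character of smash by which y acts by 0 and G trivially. *)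
Definition smash_char_gen (i : 'I_2) : K := if i == 0 then 0 else 1.

Definition free_smash_char : {rmorphism free_alg K 2 -> K} :=
  free_eval smash_char_gen (f := idfun) (fun k a => mulrC k a).

Lemma free_smash_char_rels u : u \in smash_rels -> free_smash_char u = 0.
Proof.
rewrite !inE => /orP[] /eqP-> /=.
  by rewrite /rel_sm rmorphB rmorphXn rmorph1 /= free_eval_gen /= expr1n subrr.
rewrite /rel_sy rmorphB !rmorphM rmorphXn /= free_evalZ !free_eval_gen /=.
by rewrite !mulr0 mul0r subrr.
Qed.

Definition smash_char : {rmorphism smash -> K} := qlift free_smash_char_rels.

Definition trivial_module : lmodType smash := restrict_scalars smash_char K^o.

Definition std_module : lmodType cherednik :=
  induced smash_to_cherednik trivial_module.
Definition std_vec : std_module :=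
  @tensor _ _ smash_to_cherednik trivial_module 1 (1 : K^o).

Definition irr_module : lmodType cherednik := irr_quotient std_module.

Definition irr_space : lmodType K :=
  restrict_scalars (scal cherednik_rels) irr_module.
(* The class of x^i in the irreducible quotient. *)
Definition irr_xpow (i : nat) : irr_space :=
  modpi (max_submodule_closed std_module) (cherednik_x ^+ i *: std_vec).

Definition bcoef (n : nat) : K :=
  2%:R * \sum_(1 <= j < m) (1 - lam ^+ (j * n)) / (1 - lam ^+ j) * c j.

Definition first_fixed (r : nat) :=
  [/\ (0 < r)%N, r%:R = bcoef r
    & forall n, (0 < n < r)%N -> n%:R <> bcoef n].

End RationalCherednikCyclic.

(* Main.v *)
Require Import Defs.
From HB Require Import structures.
From mathcomp Require Import all_boot all_order all_algebra.
From mathcomp Require Import reals complex.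
From mathcomp Require Import finmap boolp monalg ring.

(* H_{1,c} acts on C[x] by letting x multiply, s scale x^n by lam^n, and y    *)
(* send x^n to (n - b_n) x^(n-1). The universal property of the induced       *)
(* module turns this action into an isomorphism from M_c(C) to C[x], since    *)
(* the commutation rules of s and y with x show that the x^n (x) 1 span. The  *)
(* Euler element                                                              *)
(*     x y + sum_j 2 c_j / (1 - lam^j) (1 - s^j)                              *)
(* acts on x^n by n, so in characteristic 0 every submodule is spanned by     *)
(* monomials. If no n - b_n with 0 < n <= i vanishes, then y^i brings x^i     *)
(* back to a nonzero constant; if r = b_r, then x^r, x^(r+1), ... span a      *)
(* submodule. Finally, the numbers b_0 = 0, b_1, ..., b_(m-1) are a discrete  *)
(* Fourier transform of the c_j / (1 - lam^j), so they can be prescribed.     *)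

Set Implicit Arguments.
Unset Strict Implicit.
Unset Printing Implicit Defensive.

Import Order.TTheory GRing.Theory Num.Theory.
Local Open Scope ring_scope.

(** Put a_n = n - b_n. On polynomials x raises the degree by one, s is diagonal, and y sends x^n to
    a_n x^(n-1): a ladder that can break only where some a_n vanishes. These operators satisfy the
    relations of the algebra because b_(n+1) - b_n = 2 sum_j c_j lam^(jn) ([bcoefS]), and the
    mutually inverse equivariant maps [to_poly] and [of_poly] identify the ladder with the standard
    module.

    The Euler element separates degrees, so a submodule with a vector whose coefficient at x^i is
    nonzero contains x^i. If a_1, ..., a_i are nonzero, y takes x^i down to the generator 1 and the
    submodule is everything ([submod_full]). Conversely, a_r = 0 makes the span of x^r, x^(r+1), ...
    stable ([high_submod_closed]). Both facts together give (i). If r is the first zero, that span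
    is the largest proper submodule ([high_submod_largest]), whence the basis of the quotient
    ([irr_xpow_basis]).

    Since b_n = 0 whenever m divides n, r is never a multiple of m ([first_fixed_ndvd]). Every other
    r > 0 is reached by Fourier inversion on Z/m ([first_fixed_exists]). *)

(** * The ring of linear endomorphisms *)

Section LinearEndomorphisms.
Variables (K : comNzRingType) (V : lalgType K).

Record lin_end := LinEnd { lin_end_fun :> V -> V; _ : linear lin_end_fun }.

HB.instance Definition _ := gen_eqMixin lin_end.
HB.instance Definition _ := gen_choiceMixin lin_end.

Lemma lin_end_linear (f : lin_end) : linear f. Proof. by case: f. Qed.
HB.instance Definition _ (f : lin_end) :=
  GRing.isLinear.Build K V V *:%R f (lin_end_linear f).

Lemma lin_endP (f g : lin_end) : f =1 g -> f = g.
Proof.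
case: f g => [f f_lin] [g g_lin] /= /funext eq_fg.
by case: _ / eq_fg in g_lin *; congr LinEnd; apply: Prop_irrelevance.
Qed.

Fact end_zero_subproof : linear (fun _ : V => 0 : V).
Proof. by move=> k u v; rewrite scaler0 addr0. Qed.
Fact end_opp_subproof (f : lin_end) : linear (fun v => - f v).
Proof. by move=> k u v; rewrite linearP opprD scalerN. Qed.
Fact end_add_subproof (f g : lin_end) : linear (fun v => f v + g v).
Proof. by move=> k u v; rewrite !linearP addrACA scalerDr. Qed.
Fact end_one_subproof : linear (@id V).
Proof. by []. Qed.
Fact end_mul_subproof (f g : lin_end) : linear (fun v => f (g v)).
Proof. by move=> k u v; rewrite !linearP. Qed.
Fact end_scal_subproof (k : K) : linear (fun v : V => k *: v).
Proof. by move=> l u v; rewrite scalerDr !scalerA mulrC. Qed.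

Definition end_zero := LinEnd end_zero_subproof.
Definition end_opp f := LinEnd (end_opp_subproof f).
Definition end_add f g := LinEnd (end_add_subproof f g).
Definition end_one := LinEnd end_one_subproof.
Definition end_mul f g := LinEnd (end_mul_subproof f g).
Definition end_scal k := LinEnd (end_scal_subproof k).

Fact end_addA : associative end_add.
Proof. by move=> f g h; apply: lin_endP => v /=; rewrite addrA. Qed.
Fact end_addC : commutative end_add.
Proof. by move=> f g; apply: lin_endP => v /=; rewrite addrC. Qed.
Fact end_add0 : left_id end_zero end_add.
Proof. by move=> f; apply: lin_endP => v /=; rewrite add0r. Qed.
Fact end_addN : left_inverse end_zero end_opp end_add.
Proof. by move=> f; apply: lin_endP => v /=; rewrite addNr. Qed.

HB.instance Definition _ := GRing.isZmodule.Build lin_end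
  end_addA end_addC end_add0 end_addN.

Fact end_mulA : associative end_mul.
Proof. by move=> f g h; apply: lin_endP. Qed.
Fact end_mul1 : left_id end_one end_mul.
Proof. by move=> f; apply: lin_endP. Qed.
Fact end_mulr1 : right_id end_one end_mul.
Proof. by move=> f; apply: lin_endP. Qed.
Fact end_mulDl : left_distributive end_mul +%R.
Proof. by move=> f g h; apply: lin_endP. Qed.
Fact end_mulDr : right_distributive end_mul +%R.
Proof. by move=> f g h; apply: lin_endP => v /=; rewrite raddfD. Qed.
(** The identity does not kill the unit of [V]; this is what the [lalgType] structure provides, and
    [free_eval] requires a nonzero target ring. *)
Fact end_one_neq0 : end_one != 0.
Proof.
apply/eqP=> /(congr1 (fun f : lin_end => f 1)) /= /eqP.
by rewrite oner_eq0.
Qed.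

HB.instance Definition _ := GRing.Zmodule_isNzRing.Build lin_end
  end_mulA end_mul1 end_mulr1 end_mulDl end_mulDr end_one_neq0.

Lemma end0E v : (0 : lin_end) v = 0. Proof. by []. Qed.
Lemma endDE (f g : lin_end) v : (f + g) v = f v + g v. Proof. by []. Qed.
Lemma endNE (f : lin_end) v : (- f) v = - f v. Proof. by []. Qed.
Lemma end1E v : (1 : lin_end) v = v. Proof. by []. Qed.
Lemma endME (f g : lin_end) v : (f * g) v = f (g v). Proof. by []. Qed.
Lemma end_scalE k v : end_scal k v = k *: v. Proof. by []. Qed.
Lemma end_sumE I (r : seq I) (P : pred I) (F : I -> lin_end) v :
  (\sum_(i <- r | P i) F i) v = \sum_(i <- r | P i) F i v.
Proof. exact: (big_morph (fun f : lin_end => f v)). Qed.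

Definition endE :=
  (end0E, endDE, endNE, end1E, endME, end_scalE, end_sumE).

Fact end_scal_zmod_morphism : zmod_morphism end_scal.
Proof. by move=> k l; apply: lin_endP => v; rewrite !endE scalerBl. Qed.
Fact end_scal_monoid_morphism : monoid_morphism end_scal.
Proof.
split=> [|k l]; apply: lin_endP => v; rewrite !endE; first exact: scale1r.
by rewrite scalerA.
Qed.
HB.instance Definition _ :=
  GRing.isZmodMorphism.Build K lin_end end_scal end_scal_zmod_morphism.
HB.instance Definition _ :=
  GRing.isMonoidMorphism.Build K lin_end end_scal end_scal_monoid_morphism.

Lemma end_scal_central k (f : lin_end) : GRing.comm (end_scal k) f.
Proof. by apply: lin_endP => v; rewrite !endE linearZ. Qed.

End LinearEndomorphisms.

(** * Induction over algebras given by generators and relations *)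

Section PresentedInduction.
Variables (K : fieldType) (n : nat).

(** An element is a sum of scalar multiples of words, and a word is a product of generators, by
    induction on its length. *)
Lemma free_alg_ind (P : free_alg K n -> Prop) :
    (forall k, P (free_const n k)) -> (forall i, P (gen i)) ->
    (forall u v, P u -> P v -> P (u + v)) ->
    (forall u v, P u -> P v -> P (u * v)) ->
  forall u, P u.
Proof.
move=> Pk Pg PD PM u; rewrite [u]monalgE; elim/big_ind: _ => //.
  by have := Pk 0; rewrite raddf0.
move=> w _; have -> : << u@_w *g w >> = free_const n u@_w * << w >> :> free_alg K n.
  by rewrite /free_const malgM_def fgmulUU mul1m mulr1.
apply: (PM) => //; case: w => w; elim: w => [|i w IHw].
  have -> : FMonom [::] = @mone {fmonom 'I_n} by apply: val_inj; exact: (esym fm1).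
  exact: (Pk 1).
have -> : FMonom (i :: w) = mmul (fmu i) (FMonom w) :> {fmonom 'I_n}.
  by apply: val_inj; rewrite [RHS]fmM fmU.
have -> : << mmul (fmu i) (FMonom w) >> = gen i * << FMonom w >> :> free_alg K n.
  by rewrite /gen malgM_def fgmulUU mulr1.
exact: PM.
Qed.

Lemma pres_alg_ind (rels : seq (free_alg K n)) (P : pres_alg rels -> Prop) :
    (forall k, P (scal rels k)) -> (forall i, P (qpi (gen i))) ->
    (forall u v, P u -> P v -> P (u + v)) ->
    (forall u v, P u -> P v -> P (u * v)) ->
  forall u, P u.
Proof.
move=> Pk Pg PD PM; elim/qpi_ind=> a; elim/free_alg_ind: a => //.
- by move=> u v Pu Pv; rewrite (raddfD (@qpi _ rels)); apply: PD.
- by move=> u v Pu Pv; rewrite (rmorphM (@qpi _ rels)); apply: PM.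
Qed.

End PresentedInduction.

(** * From a basis to the dimension *)

Section BasisDimension.
Variables (K : fieldType) (V : lmodType K) (n : nat).

(** The coordinates, picked by choice, are linear by uniqueness and form the bijection onto row
    vectors that [Vector.axiom] asks for. *)
Lemma is_basis_has_dim (e : 'I_n -> V) : is_basis e -> has_dim V n.
Proof.
move=> be; pose f v := projT1 (cid (be v)).
have fP v : v = \sum_(i < n) f v 0 i *: e i /\
    forall a : 'rV[K]_n, v = \sum_(i < n) a 0 i *: e i -> f v = a.
  by rewrite /f; case: (cid _).
have fK (a : 'rV[K]_n) : f (\sum_(i < n) a 0 i *: e i) = a.
  by have [_] := fP (\sum_(i < n) a 0 i *: e i); apply.
have f_lin : linear f.
  move=> a u v; have [_] := fP (a *: u + v); apply.
  rewrite [in LHS](proj1 (fP u)) [in LHS](proj1 (fP v)).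
  rewrite scaler_sumr -big_split; apply: eq_bigr => i _ /=.
  by rewrite !mxE scalerDl scalerA.
constructor; exists f => //.
exists (fun a : 'rV[K]_n => \sum_(i < n) a 0 i *: e i) => //.
by move=> v; exact: esym (proj1 (fP v)).
Qed.

End BasisDimension.

(** * The universal property of the induced module *)

Section InducedLift.
Variables (B A : pzRingType) (f : {rmorphism B -> A}) (W : lmodType B).
Variables (U : zmodType) (g : A -> W -> U).
Hypothesis gDl : forall a a' w, g (a + a') w = g a w + g a' w.
Hypothesis gDr : forall a w w', g a (w + w') = g a w + g a w'.
Hypothesis g_bal : forall a b w, g (a * f b) w = g a (b *: w).

Let F := {malg int[(A * W)%type]}.

Definition free_lift (z : F) : U := \sum_(k <- msupp z) g k.1 k.2 *~ z@_k.

Lemma free_liftEw (d : {fset A * W}) z : (msupp z `<=` d)%fset ->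
  free_lift z = \sum_(k <- d) g k.1 k.2 *~ z@_k.
Proof.
move=> le; rewrite [LHS](big_fset_incl _ le) => //= k kd /mcoeff_outdom ->.
exact: mulr0z.
Qed.

Fact free_lift_zmod_morphism : zmod_morphism free_lift.
Proof.
move=> u v; pose d := (msupp u `|` msupp v)%fset.
rewrite !(@free_liftEw d) ?fsubsetUl ?fsubsetUr ?msuppB_le //.
by rewrite -sumrB; apply: eq_bigr=> k _; rewrite mcoeffB mulrzBr.
Qed.
HB.instance Definition _ :=
  GRing.isZmodMorphism.Build F U free_lift free_lift_zmod_morphism.

Lemma free_liftU a w : free_lift << (a, w) >> = g a w.
Proof. by rewrite (free_liftEw msuppU_le) big_seq_fset1 mcoeffUU. Qed.

(** The zeros of [free_lift] form an additive subgroup containing the tensor relations, hence the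
    subgroup that these generate. *)
Lemma free_lift_null z : z \in @tensor_null _ _ f W -> free_lift z = 0.
Proof.
move=> /tensor_nullP zN; pose N : {pred F} := fun u => free_lift u == 0.
have NE u : (u \in N) = (free_lift u == 0) by [].
apply/eqP; rewrite -NE; apply: zN => [|u ru].
  split=> [|u v]; rewrite !NE; first by rewrite raddf0.
  by move=> /eqP u0 /eqP v0; rewrite raddfB /= u0 v0 subr0.
rewrite NE; case: ru => [a a' w|a w w'|a b w]; rewrite raddfB ?raddfD /=.
- by rewrite !free_liftU gDl -opprD subrr.
- by rewrite !free_liftU gDr -opprD subrr.
- by rewrite !free_liftU g_bal subrr.
Qed.

Definition induced_lift (u : induced f W) : U :=
  free_lift (repr (u : Quotient.quot (@tensor_null _ _ f W))).

Lemma induced_lift_tpi z : induced_lift (tpi f z) = free_lift z.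
Proof.
apply/eqP; rewrite -subr_eq0 -raddfB; apply/eqP/free_lift_null/tpi_eqE.
exact: (@reprK _ (Quotient.quot (@tensor_null _ _ f W))).
Qed.

Lemma induced_lift_tensor a w : induced_lift (tensor f a w) = g a w.
Proof. by rewrite induced_lift_tpi free_liftU. Qed.

Fact induced_lift_zmod_morphism : zmod_morphism induced_lift.
Proof.
move=> u v; rewrite -[u]reprK -[v]reprK -!/(tpi f _) -(raddfB (@tpi _ _ f W)).
by rewrite !induced_lift_tpi raddfB.
Qed.

(** Pure tensors generate additively, so equivariance is checked on them. The action on [U] is given
    by [h], so that [U] can stay a mere abelian group. *)
Lemma induced_lift_scale (h : A -> {additive U -> U}) :
    (forall a a' w, g (a * a') w = h a (g a' w)) ->
  forall a u, induced_lift (a *: u) = h a (induced_lift u).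
Proof.
move=> gM a; elim/induced_ind => [a' w|u v IHu IHv].
  by rewrite [_ *: _]tscale_tensor !induced_lift_tensor.
by rewrite scalerBr !induced_lift_zmod_morphism raddfB IHu IHv.
Qed.

End InducedLift.

Section TensorOne.
Variables (B A : pzRingType) (f : {rmorphism B -> A}) (W : lmodType B).

Lemma scale_tensor1 a (w : W) : a *: tensor f 1 w = tensor f a w.
Proof. by rewrite [LHS]tscale_tensor mulr1. Qed.

Lemma scale_img_tensor1 b (w : W) : f b *: tensor f 1 w = tensor f 1 (b *: w).
Proof. by rewrite scale_tensor1 -[f b]mul1r tensor_bal. Qed.

Lemma tensor_img a b (w : W) : tensor f a (b *: w) = (a * f b) *: tensor f 1 w.
Proof. by rewrite scale_tensor1 tensor_bal. Qed.

Lemma tensor0r a : tensor f a (0 : W) = 0.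
Proof. by apply: (addrI (tensor f a 0)); rewrite -tensorDr !addr0. Qed.

End TensorOne.

(** * Arithmetic of the numbers b_n and of roots of unity *)

Section Coefficients.
Variables (K : fieldType) (m : nat) (lam : K).
Hypothesis lam_prim : m.-primitive_root lam.

Lemma prim_expr_neq1 j : (0 < j < m)%N -> 1 - lam ^+ j != 0.
Proof.
case/andP=> j_gt0 lt_jm; rewrite subr_eq0 eq_sym -(prim_order_dvd lam_prim).
by rewrite gtnNdvd.
Qed.

Lemma bcoef_dvd c n : (m %| n)%N -> bcoef m lam c n = 0.
Proof.
move=> m_n; rewrite /bcoef big1 ?mulr0 // => j _.
have /eqP -> : lam ^+ (j * n) == 1.
  by rewrite -(prim_order_dvd lam_prim) dvdn_mull.
by rewrite subrr !mul0r.
Qed.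

(** Consecutive numerators differ by lam^(jn) (1 - lam^j), which cancels the denominator; the
    commutator of y and x rests on this. *)
Lemma bcoefS c n : bcoef m lam c n.+1 =
  bcoef m lam c n + 2%:R * \sum_(1 <= j < m) c j * lam ^+ (j * n).
Proof.
rewrite /bcoef -mulrDr -big_split; congr (_ * _).
apply: eq_big_nat => j j_m /=; have nz := prim_expr_neq1 j_m.
rewrite -[c j in X in _ = _ + X]mul1r -(divff nz).
by rewrite mulnS exprD; field.
Qed.

Lemma sum_prim_expr n :
  \sum_(j < m) lam ^+ (j * n) = (m %| n)%:R * m%:R.
Proof.
case: (boolP (m %| n)%N) => [m_n|m_n].
  rewrite mul1r -[m in RHS]card_ord -sumr_const; apply: eq_bigr => j _.
  by apply/eqP; rewrite -(prim_order_dvd lam_prim) dvdn_mull.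
(* Multiplication by the nonzero [lam ^+ n - 1] turns the geometric sum into [lam ^+ (n * m) - 1],
   which vanishes. *)
rewrite mul0r; apply/eqP; rewrite -(mulrI_eq0 _ (mulfI _ (x := lam ^+ n - 1))).
  under eq_bigr do rewrite mulnC exprM.
  rewrite -subrX1 -exprM subr_eq0 -(prim_order_dvd lam_prim).
  exact: dvdn_mull.
by rewrite subr_eq0 -(prim_order_dvd lam_prim).
Qed.

End Coefficients.

(** * The defining relations under a ring morphism, for use with both [free_rep] and [qpi] *)

Section RelationImages.
Variables (K : fieldType) (m n : nat) (lam : K) (c : nat -> K).
Variables (B : pzRingType) (f : {rmorphism free_alg K n -> B}) (sc : K -> B).
Hypothesis fZ : forall k u, f (k *: u) = sc k * f u.
Implicit Types x y s : free_alg K n.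

Lemma rmorph_rel_sm s : f (rel_sm m s) = f s ^+ m - 1.
Proof. by rewrite [LHS]rmorphB rmorphXn rmorph1. Qed.

Lemma rmorph_rel_sx x s :
  f (rel_sx m lam x s) = f s * f x * f s ^+ m.-1 - sc lam * f x.
Proof. by rewrite [LHS]rmorphB !rmorphM rmorphXn fZ. Qed.

Lemma rmorph_rel_sy y s :
  f (rel_sy m lam y s) = f s * f y * f s ^+ m.-1 - sc lam^-1 * f y.
Proof. by rewrite [LHS]rmorphB !rmorphM rmorphXn fZ. Qed.

Lemma rmorph_rel_yx x y s : f (rel_yx m c x y s) = f y * f x - f x * f y -
  (1 - sc 2%:R * \sum_(1 <= j < m) sc (c j) * f s ^+ j).
Proof.
rewrite [LHS]rmorphB; congr (_ - _); rewrite [LHS]rmorphB; congr (_ - _);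
  try by [exact: rmorphM | exact: rmorph1].
rewrite [LHS]fZ rmorph_sum; congr (_ * _).
by apply: eq_bigr => j _; rewrite fZ rmorphXn.
Qed.

End RelationImages.

(** * The action of the algebra on polynomials *)

Section PolynomialRepresentation.
Variables (K : fieldType) (m : nat) (lam : K) (c : nat -> K).
Hypothesis lam_prim : m.-primitive_root lam.

Let a n := n%:R - bcoef m lam c n.

(** Past the cutoff [size p] the coefficients of [p] are 0 by default, so the formula holds at every
    index. *)
Lemma coef_poly_mul (u : nat -> K) (p : {poly K}) k i :
  (\poly_(j < size p) (u j * p`_(k + j)))`_i = u i * p`_(k + i).
Proof.
rewrite coef_poly; case: ltnP => // le_pi.
by rewrite nth_default ?mulr0 // (leq_trans le_pi) ?leq_addl.
Qed.

Fact poly_mul_linear (u : nat -> K) k :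
  linear (fun p : {poly K} => \poly_(j < size p) (u j * p`_(k + j))).
Proof.
move=> l p q; apply/polyP => i.
by rewrite coefD coefZ !coef_poly_mul coefD coefZ mulrDr mulrCA.
Qed.

Fact mulX_linear : linear (fun p : {poly K} => p * 'X).
Proof. by move=> l p q; rewrite mulrDl scalerAl. Qed.

Definition op_x : lin_end {poly K} := LinEnd mulX_linear.
Definition op_y : lin_end {poly K} :=
  LinEnd (poly_mul_linear (fun i => a i.+1) 1).
Definition op_s : lin_end {poly K} :=
  LinEnd (poly_mul_linear (fun i => lam ^+ i) 0).

Lemma coef_op_x p i : (op_x p)`_i = if i == 0 then 0 else p`_i.-1.
Proof. exact: coefMX. Qed.
Lemma coef_op_y p i : (op_y p)`_i = a i.+1 * p`_i.+1.
Proof. exact: coef_poly_mul. Qed.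
Lemma coef_op_s p i : (op_s p)`_i = lam ^+ i * p`_i.
Proof. exact: coef_poly_mul. Qed.
Lemma coef_op_sX k p i : ((op_s ^+ k) p)`_i = lam ^+ (k * i) * p`_i.
Proof.
elim: k => [|k IHk]; first by rewrite mul1r.
by rewrite exprS endME coef_op_s IHk mulrA -exprD mulSn.
Qed.

Lemma op_sm : op_s ^+ m = 1.
Proof.
apply: lin_endP => p; apply/polyP => i; rewrite coef_op_sX endE.
by rewrite exprM (prim_expr_order lam_prim) expr1n mul1r.
Qed.

Let m_gt0 : (0 < m)%N. Proof. exact: prim_order_gt0 lam_prim. Qed.

Lemma lam_neq0 : lam != 0.
Proof.
apply/eqP => lam0; have /eqP := prim_expr_order lam_prim.
by rewrite lam0 expr0n gtn_eqF // eq_sym oner_eq0.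
Qed.

Lemma lamV_expr i : lam ^+ (i + m.-1 * i) = 1.
Proof.
by rewrite -mulSn prednK // exprM (prim_expr_order lam_prim) expr1n.
Qed.

Lemma op_sx : op_s * op_x * op_s ^+ m.-1 = end_scal _ lam * op_x.
Proof.
apply: lin_endP => p; apply/polyP => i.
rewrite !endE coef_op_s coef_op_x coefZ coef_op_x.
case: i => [|i] /=; rewrite ?mulr0 // coef_op_sX mulrA -exprD addSn exprS.
by rewrite lamV_expr mulr1.
Qed.

Lemma op_sy : op_s * op_y * op_s ^+ m.-1 = end_scal _ lam^-1 * op_y.
Proof.
apply: lin_endP => p; apply/polyP => i.
rewrite !endE coef_op_s coef_op_y coefZ coef_op_y coef_op_sX.
rewrite [X in _ * X]mulrCA !mulrA -exprD; congr (_ * _ * _).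
apply: (mulfI lam_neq0); rewrite mulfV ?lam_neq0 // -exprS -addSn.
exact: lamV_expr.
Qed.

(** On x^i the left side is the scalar [a i.+1 - a i], which [bcoefS] evaluates. *)
Lemma op_yx : op_y * op_x - op_x * op_y =
  1 - end_scal _ 2%:R * \sum_(1 <= j < m) end_scal _ (c j) * op_s ^+ j.
Proof.
apply: lin_endP => p; apply/polyP => i; rewrite !endE !coefD !coefN.
rewrite coef_op_y coef_op_x coefZ coef_sum /=.
under eq_bigr do rewrite coefZ coef_op_sX mulrA.
rewrite -mulr_suml mulrA.
(* At i = 0 a multiple of x has no constant term, in agreement with [a 0 = 0], as b_0 = 0. *)
have -> : (op_x (op_y p))`_i = a i * p`_i.
  rewrite coef_op_x; case: i => [|i] /=; last by rewrite coef_op_y.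
  by rewrite /a (bcoef_dvd lam_prim) ?dvdn0 // subrr mul0r.
by rewrite -[i.+1]addn1 /a natrD addn1 (bcoefS lam_prim); ring.
Qed.

Definition rep_gen (i : 'I_3) : lin_end {poly K} :=
  if i == 0 then op_x else if i == 1 then op_y else op_s.

Definition free_rep : {rmorphism free_alg K 3 -> lin_end {poly K}} :=
  free_eval rep_gen (@end_scal_central K {poly K}).

Lemma free_repZ k u : free_rep (k *: u) = end_scal _ k * free_rep u.
Proof. exact: free_evalZ. Qed.

Lemma free_rep_rels u : u \in cherednik_rels m lam c -> free_rep u = 0.
Proof.
have rx : free_rep (gen 0) = op_x by exact: free_eval_gen.
have ry : free_rep (gen 1) = op_y by exact: free_eval_gen.
have rs : free_rep (gen 2) = op_s by exact: free_eval_gen.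
rewrite !inE => /or4P[] /eqP->.
- by rewrite rmorph_rel_sm rs op_sm subrr.
- by rewrite (rmorph_rel_sx _ _ free_repZ) rs rx op_sx subrr.
- by rewrite (rmorph_rel_sy _ _ free_repZ) rs ry op_sy subrr.
- by rewrite (rmorph_rel_yx _ _ free_repZ) rs ry rx op_yx subrr.
Qed.

Definition rep : {rmorphism cherednik m lam c -> lin_end {poly K}} :=
  qlift free_rep_rels.

Lemma rep_scal k p : rep (scal _ k) p = k *: p.
Proof.
have -> : rep (scal _ k) = free_rep (free_const 3 k) by exact: qlift_pi.
have -> : free_const 3 k = k *: 1 by rewrite -mul_malgC mulr1.
by rewrite free_repZ rmorph1 mulr1.
Qed.
Lemma rep_x : rep (cherednik_x m lam c) = op_x.
Proof. by rewrite [LHS]qlift_pi; exact: free_eval_gen. Qed.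
Lemma rep_y : rep (cherednik_y m lam c) = op_y.
Proof. by rewrite [LHS]qlift_pi; exact: free_eval_gen. Qed.
Lemma rep_s : rep (cherednik_s m lam c) = op_s.
Proof. by rewrite [LHS]qlift_pi; exact: free_eval_gen. Qed.

End PolynomialRepresentation.

(** * Common eigenvectors, and the map from the standard module to polynomials *)

Section Eigenvectors.
Variables (K : comNzRingType) (V : lalgType K) (B A : pzRingType).
Variables (f : {rmorphism B -> A}) (g : {rmorphism A -> lin_end V}).
Variables (chi : {rmorphism B -> K}) (v : V).

Lemma eigenvectorD b b' :
    g (f b) v = chi b *: v -> g (f b') v = chi b' *: v ->
  g (f (b + b')) v = chi (b + b') *: v.
Proof. by move=> bv b'v; rewrite !rmorphD endDE bv b'v scalerDl. Qed.

Lemma eigenvectorM b b' :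
    g (f b) v = chi b *: v -> g (f b') v = chi b' *: v ->
  g (f (b * b')) v = chi (b * b') *: v.
Proof.
by move=> bv b'v; rewrite !rmorphM endME b'v linearZ /= bv scalerA mulrC.
Qed.

End Eigenvectors.

Section StandardModule.
Variables (K : fieldType) (m : nat) (lam : K) (c : nat -> K).
Hypothesis lam_prim : m.-primitive_root lam.

Local Notation A := (cherednik m lam c).
Local Notation M := (std_module m lam c).
Local Notation W := (trivial_module m lam).
Local Notation rep := (rep c lam_prim).
Local Notation iota := (smash_to_cherednik m lam c).

Lemma smash_ind (P : smash m lam -> Prop) :
    (forall k, P (scal _ k)) -> P (smash_y m lam) -> P (smash_s m lam) ->
    (forall u v, P u -> P v -> P (u + v)) ->
    (forall u v, P u -> P v -> P (u * v)) ->
  forall u, P u.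
Proof.
move=> Pk Py Ps PD PM; apply: pres_alg_ind => // i.
case: (unliftP ord0 i) => [j ->|-> //].
by have -> : lift ord0 j = 1 by apply: val_inj; case: j => [[]].
Qed.

Lemma cherednik_ind (P : A -> Prop) :
    (forall k, P (scal _ k)) -> P (cherednik_x m lam c) ->
    P (cherednik_y m lam c) -> P (cherednik_s m lam c) ->
    (forall u v, P u -> P v -> P (u + v)) ->
    (forall u v, P u -> P v -> P (u * v)) ->
  forall u, P u.
Proof.
move=> Pk Px Py Ps PD PM; apply: pres_alg_ind => // i.
case: (unliftP ord0 i) => [j ->|-> //].
case: (unliftP ord0 j) => [l ->|->].
  by have -> : lift ord0 (lift ord0 l) = 2 :> 'I_3;
    first by apply: val_inj; case: l => [[]].
by have -> : lift ord0 ord0 = 1 :> 'I_3 by apply: val_inj.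
Qed.

Lemma iota_scal k : iota (scal _ k) = scal _ k.
Proof.
have -> : iota (scal _ k) = free_smash_to_cherednik m lam c (free_const 2 k).
  exact: qlift_pi.
rewrite /free_smash_to_cherednik /=.
have -> : free_const 2 k = k *: 1 by rewrite -mul_malgC mulr1.
by rewrite free_evalZ rmorph1 mulr1.
Qed.

Lemma iota_y : iota (smash_y m lam) = cherednik_y m lam c.
Proof. by rewrite [LHS]qlift_pi /= free_eval_gen. Qed.
Lemma iota_s : iota (smash_s m lam) = cherednik_s m lam c.
Proof. by rewrite [LHS]qlift_pi /= free_eval_gen. Qed.

Lemma smash_char_scal k : smash_char m lam (scal _ k) = k.
Proof.
have -> : smash_char m lam (scal _ k) = free_smash_char K (free_const 2 k).
  exact: qlift_pi.
have -> : free_const 2 k = k *: 1 by rewrite -mul_malgC mulr1.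
by rewrite [LHS]free_evalZ rmorph1 mulr1.
Qed.
Lemma smash_char_y : smash_char m lam (smash_y m lam) = 0.
Proof. by rewrite [LHS]qlift_pi [LHS]free_eval_gen. Qed.
Lemma smash_char_s : smash_char m lam (smash_s m lam) = 1.
Proof. by rewrite [LHS]qlift_pi [LHS]free_eval_gen. Qed.

(** On generators: y kills 1 and s fixes it. Thereby [act_poly] is balanced and descends to the
    tensor product. *)
Lemma rep_iota1 b : rep (iota b) 1 = smash_char m lam b *: 1.
Proof.
elim/smash_ind: b => [k|||u v|u v].
- by rewrite iota_scal smash_char_scal rep_scal.
- rewrite iota_y smash_char_y rep_y scale0r.
  by apply/polyP => k; rewrite coef_op_y coef1 mulr0 coef0.
- rewrite iota_s smash_char_s rep_s scale1r.
  apply/polyP => k; rewrite coef_op_s coef1.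
  by case: k => [|k]; rewrite ?mulr1 ?mulr0.
- exact: eigenvectorD.
- exact: eigenvectorM.
Qed.

Let act_poly (u : A) (w : W) : {poly K} := rep u ((w : K) %:P).

Fact act_polyDl u u' w : act_poly (u + u') w = act_poly u w + act_poly u' w.
Proof. by rewrite /act_poly [rep _]rmorphD. Qed.
Fact act_polyDr u w w' : act_poly u (w + w') = act_poly u w + act_poly u w'.
Proof. by rewrite /act_poly polyCD linearD. Qed.
Fact act_poly_bal u b w : act_poly (u * iota b) w = act_poly u (b *: w).
Proof.
rewrite /act_poly [rep _]rmorphM endME -[(w : K)%:P]alg_polyC linearZ /=.
by rewrite rep_iota1 scalerA mulrC -alg_polyC.
Qed.

Definition to_poly : M -> {poly K} := @induced_lift _ _ iota W _ act_poly.

Lemma to_poly_tensor u w : to_poly (tensor iota u w) = rep u (w : K)%:P.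
Proof. exact: (induced_lift_tensor act_polyDl act_polyDr act_poly_bal). Qed.

Fact to_poly_zmod_morphism : zmod_morphism to_poly.
Proof.
exact: (induced_lift_zmod_morphism act_polyDl act_polyDr act_poly_bal).
Qed.
HB.instance Definition _ :=
  GRing.isZmodMorphism.Build M {poly K} to_poly to_poly_zmod_morphism.

Lemma to_polyZ u v : to_poly (u *: v) = rep u (to_poly v).
Proof.
apply: (induced_lift_scale act_polyDl act_polyDr act_poly_bal
  (h := fun u => rep u : {additive {poly K} -> {poly K}})) => u' u'' w.
by rewrite /act_poly [rep _]rmorphM.
Qed.

Local Notation vac := (std_vec m lam c : M).

Lemma to_poly_vac : to_poly vac = 1.
Proof. by rewrite [LHS]to_poly_tensor [rep _]rmorph1. Qed.

Lemma iota_vac b : iota b *: vac = tensor iota 1 (smash_char m lam b : W).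
Proof.
rewrite [LHS]scale_img_tensor1; congr (tensor _ _ _).
exact: mulr1.
Qed.

Lemma s_vac : cherednik_s m lam c *: vac = vac.
Proof. by rewrite -iota_s iota_vac smash_char_s. Qed.

Lemma y_vac : cherednik_y m lam c *: vac = 0.
Proof. by rewrite -iota_y iota_vac smash_char_y; exact: tensor0r. Qed.

(** The scalar [k] of the smash product acts on the trivial module as [k] and so crosses the tensor
    sign. Hence [vac] generates the standard module. *)
Lemma tensor_vac u (k : K) : tensor iota u (k : W) = (u * scal _ k) *: vac.
Proof.
rewrite -iota_scal -[RHS]tensor_img; congr (tensor _ _ _).
exact: (esym (etrans (mulr1 _) (smash_char_scal k))).
Qed.

End StandardModule.

(** * Applying polynomials in x to a vector, and intertwining *)

Section PolynomialAction.
Variables (K : fieldType) (A : pzRingType) (sc : {rmorphism K -> A}) (x : A).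
Hypothesis sc_central : forall k a, sc k * a = a * sc k.
Variables (V : lmodType A) (v : V).
Implicit Types p q : {poly K}.

Definition poly_act (p : {poly K}) : V :=
  \sum_(i < size p) (sc p`_i * x ^+ i) *: v.

Lemma poly_actEw n p : (size p <= n)%N ->
  poly_act p = \sum_(i < n) (sc p`_i * x ^+ i) *: v.
Proof.
move=> le_pn; rewrite /poly_act.
rewrite (big_ord_widen _ (fun i => (sc p`_i * x ^+ i) *: v) le_pn) big_mkcond.
apply: eq_bigr => i _; case: ltnP => // le_pi.
by rewrite nth_default // raddf0 mul0r scale0r.
Qed.

Fact poly_act_zmod_morphism : zmod_morphism poly_act.
Proof.
move=> p q; pose n := maxn (size p) (size q).
rewrite !(@poly_actEw n) ?leq_maxl ?leq_maxr //; last first.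
  by rewrite (leq_trans (size_polyD _ _)) ?size_polyN.
rewrite -sumrB; apply: eq_bigr => i _.
by rewrite coefB raddfB mulrBl scalerBl.
Qed.
HB.instance Definition _ :=
  GRing.isZmodMorphism.Build {poly K} V poly_act poly_act_zmod_morphism.

Lemma poly_actZ k p : poly_act (k *: p) = sc k *: poly_act p.
Proof.
rewrite (@poly_actEw (size p)) ?size_scale_leq // scaler_sumr.
by apply: eq_bigr => i _; rewrite coefZ rmorphM scalerA mulrA.
Qed.

Lemma poly_actMX p : poly_act (p * 'X) = x *: poly_act p.
Proof.
have le_pX : (size (p * 'X)%R <= (size p).+1)%N.
  by rewrite (leq_trans (size_polyMleq _ _)) // size_polyX addn2.
rewrite (poly_actEw le_pX) big_ord_recl coefMX /= raddf0 mul0r scale0r add0r.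
rewrite scaler_sumr; apply: eq_bigr => i _.
by rewrite coefMX /= scalerA mulrA -sc_central -mulrA -exprS.
Qed.

Lemma poly_act1 : poly_act 1 = v.
Proof. by rewrite /poly_act size_poly1 big_ord1 coef1 rmorph1 mulr1 scale1r. Qed.

Lemma poly_actXn i : poly_act 'X^i = x ^+ i *: v.
Proof.
elim: i => [|i IHi]; first by rewrite poly_act1 scale1r.
by rewrite exprSr poly_actMX IHi scalerA -exprS.
Qed.

Variable r : {rmorphism A -> lin_end {poly K}}.
Hypothesis r_sc : forall k p, r (sc k) p = k *: p.
Hypothesis r_x : forall p, r x p = p * 'X.

Definition intertwines a := forall p, poly_act (r a p) = a *: poly_act p.

Lemma intertwines_sc k : intertwines (sc k).
Proof. by move=> p; rewrite r_sc poly_actZ. Qed.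
Lemma intertwines_x : intertwines x.
Proof. by move=> p; rewrite r_x poly_actMX. Qed.
Lemma intertwinesD a b : intertwines a -> intertwines b -> intertwines (a + b).
Proof. by move=> ia ib p; rewrite rmorphD endE raddfD /= ia ib scalerDl. Qed.
Lemma intertwines0 : intertwines 0.
Proof. by rewrite -(raddf0 sc); apply: intertwines_sc. Qed.
Lemma intertwines1 : intertwines 1.
Proof. by rewrite -(rmorph1 sc); apply: intertwines_sc. Qed.
Lemma intertwinesB a b : intertwines a -> intertwines b -> intertwines (a - b).
Proof. by move=> ia ib p; rewrite rmorphB !endE raddfB /= ia ib scalerBl. Qed.
Lemma intertwinesM a b : intertwines a -> intertwines b -> intertwines (a * b).
Proof. by move=> ia ib p; rewrite rmorphM endME ia ib scalerA. Qed.
Lemma intertwinesX a n : intertwines a -> intertwines (a ^+ n).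
Proof.
move=> ia; elim: n => [|n IHn]; last by rewrite exprS; apply: intertwinesM.
by rewrite expr0; apply: intertwines1.
Qed.
Lemma intertwines_sum I (s : seq I) (P : pred I) F :
  (forall i, P i -> intertwines (F i)) -> intertwines (\sum_(i <- s | P i) F i).
Proof.
move=> iF; apply: big_ind => //; last exact: intertwinesD.
exact: intertwines0.
Qed.

(* Moving a across x propagates the intertwining property from 1 to all       *)
(* polynomials; this avoids computing the action of y on x^n inside M.        *)
Lemma intertwines_comm a u d : a * x = u * a + d ->
  intertwines u -> intertwines d -> poly_act (r a 1) = a *: v -> intertwines a.
Proof.
move=> ax iu idd a1; elim/poly_ind => [|q k IHq]; first by rewrite !raddf0.
rewrite -[k%:P]alg_polyC [r a _]linearD /= [r a (k *: 1)]linearZ /=.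
rewrite [LHS]raddfD [poly_act (_ + _)]raddfD /= !poly_actZ a1 poly_act1.
rewrite scalerDr !scalerA sc_central; congr (_ + _).
rewrite poly_actMX scalerA ax scalerDl -scalerA -IHq -iu -idd -raddfD /=.
by congr poly_act; rewrite -r_x -endME -rmorphM ax rmorphD rmorphM.
Qed.

End PolynomialAction.

Lemma eqr_nat_pchar0 (K : fieldType) (i j : nat) : [pchar K] =i pred0 ->
  (i%:R == j%:R :> K) = (i == j).
Proof.
move=> /pcharf0P natr_eq0; wlog le_ji : i j / (j <= i)%N => [th|].
  have [/th //|/ltnW /th] := leqP j i.
  by rewrite eq_sym => ->; rewrite eq_sym.
by rewrite -subr_eq0 -natrB // natr_eq0 subn_eq0 eqn_leq le_ji andbT.
Qed.

(** * Subspaces of polynomials stable under a degree operator and a lowering operator *)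

Section PolynomialSubmodules.
Variables (K : fieldType) (a : nat -> K).
Hypothesis charK : [pchar K] =i pred0.
Variables (S : {pred {poly K}}) (E Y : {poly K} -> {poly K}).
Hypothesis subS : submod_closed S.
Hypothesis SE : forall p, p \in S -> E p \in S.
Hypothesis SY : forall p, p \in S -> Y p \in S.
Hypothesis coefE : forall p i, (E p)`_i = i%:R * p`_i.
Hypothesis coefY : forall p i, (Y p)`_i = a i.+1 * p`_i.+1.

Let SZ k p : p \in S -> k *: p \in S.
Proof. exact: (GRing.subsemimod_closedZ (GRing.submod_closed_semi subS)). Qed.

(* The product of the operators E - k, for k != i, kills all monomials of p   *)
(* but 'X^i.                                                                  *)
Lemma submod_monomial p i : p \in S -> p`_i != 0 -> 'X^i \in S.
Proof.
move=> pS pi_n0; pose ks := [seq k <- iota 0 (size p) | k != i].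
have [q qS qE] : exists2 q, q \in S &
    forall j, q`_j = (\prod_(k <- ks) (j%:R - k%:R)) * p`_j.
  elim: (ks) => [|k ks' [q qS qE]].
    by exists p => // j; rewrite big_nil mul1r.
  exists (E q - k%:R *: q).
    by have [_ SB] := GRing.submod_closedB subS; apply: SB; [apply: SE|apply: SZ].
  by move=> j; rewrite coefB coefZ coefE -mulrBl qE big_cons mulrA.
have qi_n0 : q`_i != 0.
  rewrite qE mulf_neq0 // prodf_seq_neq0; apply/allP => k.
  by rewrite mem_filter => /andP[ne_ki _] /=; rewrite subr_eq0 eqr_nat_pchar0 // eq_sym.
have -> : 'X^i = (q`_i)^-1 *: q; last exact: SZ.
apply/polyP => j; rewrite coefZ coefXn; have [->|ne_ji] := eqVneq j i.
  by rewrite mulVf.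
rewrite [q`_j]qE; case: (ltnP j (size p)) => [lt_jp|le_pj]; last first.
  by rewrite [p`_j]nth_default // !mulr0.
have j_ks : j \in ks by rewrite mem_filter ne_ji mem_iota.
by rewrite (big_rem j j_ks) /= subrr !mul0r mulr0.
Qed.

(** [submod_monomial] puts ['X^i] in [S]; then [Y], followed by division by the nonzero [a i], ...,
    [a 1] in turn, descends to 1. *)
Lemma submod_one p i : p \in S -> p`_i != 0 ->
  (forall k, (0 < k <= i)%N -> a k != 0) -> 1 \in S.
Proof.
move=> pS pi_n0 a_n0; have XiS := submod_monomial pS pi_n0.
clear pi_n0; elim: i a_n0 XiS => [|i IHi] a_n0 XS; first by rewrite expr0 in XS.
apply: IHi => [k /andP[k_gt0 le_ki]|]; first by rewrite a_n0 // k_gt0 leqW.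
have -> : 'X^i = (a i.+1)^-1 *: Y 'X^(i.+1); last exact/SZ/SY.
apply/polyP => j; rewrite coefZ coefY !coefXn eqSS.
by have [->|_] := eqVneq j i; rewrite ?mulr1 ?mulr0 // mulVf // a_n0 ?ltnS ?leqnn.
Qed.

End PolynomialSubmodules.

(** * The Euler element *)

Section EulerElement.
Variables (K : fieldType) (m : nat) (lam : K) (c : nat -> K).

(* x y acts on x^n by n - b_n, and the sum adds b_n back.                     *)
Definition euler (B : pzRingType) (sc : K -> B) (x y s : B) : B :=
  x * y +
  \sum_(1 <= j < m) sc (2%:R * c j / (1 - lam ^+ j)) * (1 - s ^+ j).

(** [euler] is written over an arbitrary ring so that the element of the algebra and the operator it
    induces are the same expression. *)
Lemma rmorph_euler (B B' : pzRingType) (g : {rmorphism B -> B'}) sc x y s :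
  g (euler sc x y s) = euler (fun k => g (sc k)) (g x) (g y) (g s).
Proof.
rewrite /euler rmorphD rmorphM rmorph_sum; congr (_ + _).
by apply: eq_bigr => j _; rewrite rmorphM rmorphB rmorph1 rmorphXn.
Qed.

Lemma coef_op_euler (sc : K -> lin_end {poly K}) (p : {poly K}) i :
    m.-primitive_root lam -> (forall k q, sc k q = k *: q) ->
  (euler sc (op_x K) (op_y m lam c) (op_s lam) p)`_i = i%:R * p`_i.
Proof.
move=> lam_prim scE; rewrite /euler endDE endME end_sumE coefD coef_sum.
under eq_bigr do rewrite endME scE coefZ !endE coefB coef_op_sX.
have -> : (op_x K (op_y m lam c p))`_i = (i%:R - bcoef m lam c i) * p`_i.
  rewrite coef_op_x; case: i => [|i] /=; last by rewrite coef_op_y.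
  by rewrite (bcoef_dvd lam_prim) ?dvdn0 // subrr mul0r.
set b := \sum_(1 <= j < m) _; have -> : b = bcoef m lam c i * p`_i.
  rewrite /b /bcoef mulr_sumr mulr_suml; apply: eq_bigr => j _; ring.
by rewrite -mulrDl subrK.
Qed.

End EulerElement.

Lemma conjX_comm (A : pzRingType) m (s x u : A) : (0 < m)%N -> s ^+ m = 1 ->
  s * x * s ^+ m.-1 - u = 0 -> s * x = u * s.
Proof.
move=> m_gt0 sm /eqP; rewrite subr_eq0 => /eqP <-.
by rewrite -mulrA -exprSr prednK // sm mulr1.
Qed.

Lemma subr2_eq0 (V : zmodType) (u v w : V) : u - v - w = 0 -> u = v + w.
Proof. by move=> /eqP; rewrite subr_eq0 subr_eq addrC => /eqP. Qed.

(** * The standard module is the polynomial module; its submodules *)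

Section StandardModuleIsomorphism.
Variables (K : fieldType) (m : nat) (lam : K) (c : nat -> K).
Hypothesis lam_prim : m.-primitive_root lam.

Local Notation A := (cherednik m lam c).
Local Notation M := (std_module m lam c).
Local Notation rels := (cherednik_rels m lam c).
Local Notation rep := (rep c lam_prim).
Local Notation to_poly := (@to_poly K m lam c lam_prim).
Local Notation vac := (std_vec m lam c : M).
Local Notation x := (cherednik_x m lam c).
Local Notation y := (cherednik_y m lam c).
Local Notation s := (cherednik_s m lam c).
Local Notation sc := (scal rels).

Lemma qpi_rel0 u : u \in rels -> (qpi u : A) = 0.
Proof.
move=> uR; rewrite -(raddf0 (@qpi _ rels)); apply/qpi_eqE.
by rewrite subr0; apply: sub_ideal_gen.
Qed.

Lemma qpiZ k (u : free_alg K 3) : (qpi (k *: u) : A) = sc k * qpi u.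
Proof. by rewrite -mul_malgC; exact: rmorphM. Qed.

Lemma cherednik_sm : s ^+ m = 1.
Proof.
apply: subr0_eq; rewrite -(rmorph_rel_sm m (@qpi _ rels)); apply: qpi_rel0.
exact: (@mem_nth _ 0 rels 0 isT).
Qed.

Lemma cherednik_sx : s * x = sc lam * x * s.
Proof.
apply: (conjX_comm (prim_order_gt0 lam_prim) cherednik_sm).
rewrite -(rmorph_rel_sx m lam qpiZ); apply: qpi_rel0.
exact: (@mem_nth _ 0 rels 1 isT).
Qed.

Lemma cherednik_yx : y * x = x * y +
  (1 - sc 2%:R * \sum_(1 <= j < m) sc (c j) * s ^+ j).
Proof.
apply: subr2_eq0; rewrite -(rmorph_rel_yx m c qpiZ); apply: qpi_rel0.
exact: (@mem_nth _ 0 rels 3 isT).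
Qed.

Definition of_poly : {poly K} -> M := poly_act sc x vac.

(** It suffices to treat scalars, x, s and y. The last two follow from [intertwines_comm]; s
    precedes y because the correction term in the relation for y x is a combination of powers of
    s. *)
Lemma of_poly_rep u p : of_poly (rep u p) = u *: of_poly p.
Proof.
have sc_c := @scal_central K 3 rels.
have r_sc k q : rep (sc k) q = k *: q by exact: rep_scal.
have r_x q : rep x q = q * 'X by rewrite rep_x.
suff: intertwines sc x vac rep u by exact.
have is_sc k : intertwines sc x vac rep (sc k) by exact: intertwines_sc.
have is_x : intertwines sc x vac rep x by exact: intertwines_x.
have is_s : intertwines sc x vac rep s.
  apply: (@intertwines_comm _ A sc x sc_c M vac rep r_x s (sc lam * x) 0).
  - by rewrite addr0; exact: cherednik_sx.
  - by apply: intertwinesM; [exact: is_sc | exact: is_x].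
  - exact: (intertwines0 _ _ r_sc).
  - rewrite rep_s s_vac -[RHS](poly_act1 sc x vac); congr poly_act.
    apply/polyP => k; rewrite coef_op_s coef1.
    by case: k => [|k]; rewrite ?mulr1 ?mulr0.
have is_y : intertwines sc x vac rep y.
  apply: (@intertwines_comm _ A sc x sc_c M vac rep r_x y x _ cherednik_yx).
  - exact: is_x.
  - apply: intertwinesB; first exact: (intertwines1 _ _ r_sc).
    apply: intertwinesM; first exact: is_sc.
    apply: (intertwines_sum r_sc) => j _.
    apply: intertwinesM; first exact: is_sc.
    exact: (intertwinesX r_sc _ is_s).
  - rewrite rep_y y_vac -[RHS](raddf0 (poly_act sc x vac)); congr poly_act.
    by apply/polyP => k; rewrite coef_op_y coef1 mulr0 coef0.
elim/cherednik_ind: u => [k||||u v iu iv|u v iu iv].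
- exact: is_sc.
- exact: is_x.
- exact: is_y.
- exact: is_s.
- exact: intertwinesD.
- exact: intertwinesM.
Qed.

Lemma of_poly1 : of_poly 1 = vac.
Proof. exact: poly_act1. Qed.

Lemma of_polyZ k p : of_poly (k *: p) = sc k *: of_poly p.
Proof. exact: poly_actZ. Qed.

Lemma of_polyXn i : of_poly 'X^i = x ^+ i *: vac.
Proof. exact: (@poly_actXn K A sc x (@scal_central K 3 rels) M vac i). Qed.

Fact of_poly_zmod_morphism : zmod_morphism of_poly.
Proof. exact: poly_act_zmod_morphism. Qed.
HB.instance Definition _ :=
  GRing.isZmodMorphism.Build {poly K} M of_poly of_poly_zmod_morphism.

Lemma to_poly_sc k u : to_poly (sc k *: u) = k *: to_poly u.
Proof. exact: etrans (to_polyZ _ _ _) (rep_scal _ _ _ _). Qed.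

(** Both maps are equivariant and exchange 1 with [vac], and these vectors generate their modules;
    [to_polyK] holds for the same reason. *)
Lemma of_polyK : cancel of_poly to_poly.
Proof.
have xE p : rep x p = p * 'X by rewrite rep_x.
elim/poly_ind => [|p k IHp]; first by rewrite !raddf0.
rewrite [of_poly _]raddfD [LHS]raddfD; congr (_ + _).
  by rewrite -[in LHS]xE /= of_poly_rep to_polyZ IHp xE.
by rewrite -alg_polyC /= of_polyZ of_poly1 to_poly_sc to_poly_vac.
Qed.

Lemma to_polyK : cancel to_poly of_poly.
Proof.
elim/induced_ind => [u w|u v IHu IHv]; last by rewrite !raddfB /= IHu IHv.
rewrite to_poly_tensor of_poly_rep -alg_polyC of_polyZ of_poly1.
by rewrite scalerA -tensor_vac.
Qed.

Lemma submod_vac (N : {pred M}) : submod_closed N -> vac \in N ->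
  forall u, u \in N.
Proof.
move=> subN vacN u.
have NZ := GRing.subsemimod_closedZ (GRing.submod_closed_semi subN).
elim/induced_ind: u => [u w|u v uN vN].
  by rewrite tensor_vac; apply: NZ.
by have [_ NB] := GRing.submod_closedB subN; apply: NB.
Qed.

Lemma to_poly_euler u i :
  (to_poly (euler m lam c sc x y s *: u))`_i = i%:R * (to_poly u)`_i.
Proof.
rewrite to_polyZ rmorph_euler rep_x rep_y rep_s.
by apply: coef_op_euler => // k q; exact: rep_scal.
Qed.

(** The polynomials that [of_poly] sends into [N] form a subspace stable under the Euler element and
    y, so [submod_one] yields 1 there, that is, [vac] in [N]. *)
Lemma submod_full (N : {pred M}) v i : [pchar K] =i pred0 ->
    submod_closed N -> v \in N -> (to_poly v)`_i != 0 ->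
    (forall k, (0 < k <= i)%N -> k%:R - bcoef m lam c k != 0) ->
  forall u, u \in N.
Proof.
move=> charK subN vN vi_n0 a_n0; apply: submod_vac => //.
pose S : {pred {poly K}} := fun p => of_poly p \in N.
have SE p : (p \in S) = (of_poly p \in N) by [].
have NZ := GRing.subsemimod_closedZ (GRing.submod_closed_semi subN).
have [N0 NB] := GRing.submod_closedB subN.
have ND u w : u \in N -> w \in N -> u + w \in N.
  by move=> uN wN; case: subN => _ /(_ 1 u w uN wN); rewrite scale1r.
have Srep u p : p \in S -> rep u p \in S.
  by rewrite !SE of_poly_rep; apply: NZ.
rewrite -of_poly1 -SE.
apply: (@submod_one _ _ charK S (rep (euler m lam c sc x y s)) (rep y) _ _ _ _ _
  (to_poly v) i _ vi_n0 a_n0).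
- split=> [|k p q]; rewrite !SE; first by rewrite raddf0.
  by move=> pN qN; rewrite raddfD /= of_polyZ ND // NZ.
- by move=> p; apply: Srep.
- by move=> p; apply: Srep.
- by move=> p j; rewrite -{1}[p]of_polyK -to_polyZ to_poly_euler of_polyK.
- by move=> p j; rewrite rep_y coef_op_y.
- by rewrite SE to_polyK.
Qed.

(** In terms of polynomials this is the ideal generated by x^r. *)
Definition high_submod r : {pred M} :=
  fun u => [forall i : 'I_r, (to_poly u)`_i == 0].

Lemma high_submodP r u :
  reflect (forall i, (i < r)%N -> (to_poly u)`_i = 0) (u \in high_submod r).
Proof.
apply: (iffP forallP) => [u0 i lt_ir|u0 i]; last by rewrite u0.
by have /eqP := u0 (Ordinal lt_ir).
Qed.

(** Only y lowers degrees, and the one exit from the span, from x^r to x^(r-1), carries the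
    coefficient r - b_r = 0. *)
Lemma high_submod_closed r : r%:R - bcoef m lam c r = 0 ->
  submod_closed (high_submod r).
Proof.
move=> ar0.
have hD u v : u \in high_submod r -> v \in high_submod r ->
    u + v \in high_submod r.
  move=> /high_submodP u0 /high_submodP v0; apply/high_submodP => i lt_ir.
  by rewrite raddfD coefD u0 ?v0 ?addr0.
split=> [|a u v uJ vJ]; first by apply/high_submodP => i _; rewrite raddf0 coef0.
suff auJ : a *: u \in high_submod r by exact: hD.
(* The vector is generalized because the product case applies the hypothesis on [a] to [b *: u]. *)
move: {vJ} u uJ; elim/cherednik_ind: a => [k u|u|u|u|a b IHa IHb u|a b IHa IHb u].
- move=> /high_submodP u0; apply/high_submodP => i lt_ir.
  by rewrite to_polyZ rep_scal coefZ u0 // mulr0.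
- move=> /high_submodP u0; apply/high_submodP => i lt_ir.
  rewrite to_polyZ rep_x coef_op_x; case: i lt_ir => //= i /ltnW; exact: u0.
- move=> /high_submodP u0; apply/high_submodP => i lt_ir.
  rewrite to_polyZ rep_y coef_op_y; have [->|lt_iSr] := eqVneq i.+1 r.
    by rewrite ar0 mul0r.
  by rewrite u0 ?mulr0 // ltn_neqAle lt_iSr.
- move=> /high_submodP u0; apply/high_submodP => i lt_ir.
  by rewrite to_polyZ rep_s coef_op_s u0 // mulr0.
- by move=> uJ; rewrite scalerDl; apply: hD; auto.
- by move=> uJ; rewrite -scalerA; auto.
Qed.

End StandardModuleIsomorphism.

(** * Irreducibility, the largest proper submodule and the basis of the quotient *)

Section MainResults.
Variables (K : fieldType) (m : nat) (lam : K) (c : nat -> K).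
Hypothesis charK : [pchar K] =i pred0.
Hypothesis lam_prim : m.-primitive_root lam.

Local Notation M := (std_module m lam c).
Local Notation to_poly := (@to_poly K m lam c lam_prim).
Local Notation of_poly := (@of_poly K m lam c).
Local Notation vac := (std_vec m lam c : M).
Local Notation J := (@high_submod K m lam c lam_prim).

Lemma vac_high_submod r : (0 < r)%N -> vac \notin J r.
Proof.
move=> r_gt0; apply/high_submodP => /(_ 0 r_gt0) /eqP.
by rewrite to_poly_vac coef1 oner_eq0.
Qed.

(** If n = b_n, then [J n] is a submodule that contains x^n but not 1. Otherwise [submod_full]
    applies to any nonzero vector, at the degree of its polynomial. *)
Lemma std_module_irreducible : irreducible_module M <->
  forall n, (1 <= n)%N -> n%:R - bcoef m lam c n != 0.
Proof.
split=> [[_ irrM] n n_gt0|a_n0].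
  apply/negP => /eqP an0.
  have [J0|JT] := irrM _ (high_submod_closed lam_prim an0); last first.
    by have := vac_high_submod n_gt0; rewrite JT.
  have /J0 Xn0 : of_poly 'X^n \in J n.
    apply/high_submodP => i lt_in; rewrite of_polyK coefXn.
    by rewrite ltn_eqF.
  have /(congr1 (fun p : {poly K} => p`_n)) := of_polyK c lam_prim 'X^n.
  by rewrite Xn0 raddf0 coefXn coef0 eqxx => /esym/eqP; rewrite oner_eq0.
split=> [|N subN].
  exists vac; apply/eqP => vac0; have := to_poly_vac c lam_prim.
  by rewrite vac0 raddf0 => /esym/eqP; rewrite oner_eq0.
have [[v [vN v_n0]]|Nn0] := pselect (exists v, v \in N /\ v != 0); last first.
  by left=> v vN; apply: contrapT => /eqP v_n0; apply: Nn0; exists v.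
right; pose p := to_poly v.
have p_n0 : p != 0.
  apply: contra v_n0 => /eqP p0.
  by rewrite -[v](to_polyK lam_prim) -/p p0 raddf0.
apply: (submod_full charK subN vN (i := (size p).-1)) => [|k /andP[k_gt0 _]].
  by rewrite -lead_coefE lead_coef_eq0.
exact: a_n0.
Qed.

Section FirstFixed.
Variable r : nat.
Hypothesis r_first : first_fixed m lam c r.

(** A vector with a nonzero coefficient at some i < r generates everything by [submod_full], since
    minimality of r excludes k = b_k for 0 < k <= i. *)
Lemma high_submod_largest : largest_proper_submodule (J r).
Proof.
have [r_gt0 rE a_n0] := r_first.
split; first split.
- by apply: high_submod_closed; rewrite rE subrr.
- by exists vac; apply: vac_high_submod.
move=> N [subN [w wN]] v vN; apply/high_submodP => i lt_ir.
apply/eqP; apply: contraNT wN => vi_n0.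
apply: (submod_full charK subN vN vi_n0) => k /andP[k_gt0 le_ki].
by rewrite subr_eq0; apply/eqP/a_n0; rewrite k_gt0 (leq_ltn_trans le_ki).
Qed.

Lemma irr_xpow_comb (a : 'rV[K]_r) :
  \sum_(i < r) a 0 i *: irr_xpow m lam c i =
  modpi (max_submodule_closed M) (of_poly (\sum_(i < r) a 0 i *: 'X^i)).
Proof.
rewrite [of_poly _]raddf_sum [RHS]raddf_sum; apply: eq_bigr => i _ /=.
rewrite of_polyZ of_polyXn.
by rewrite [RHS](modpi_scalable (max_submodule_closed M)).
Qed.

Lemma irr_xpow_basis : is_basis (fun i : 'I_r => irr_xpow m lam c i).
Proof.
(* A class is determined by the coefficients of degree below r, which are therefore its coordinates;
   existence and uniqueness both follow. *)
have eq_comb u (a : 'rV[K]_r) : (modpi (max_submodule_closed M) u : irr_space m lam c) =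
      \sum_(i < r) a 0 i *: irr_xpow m lam c i <->
    forall i : 'I_r, (to_poly u)`_i = a 0 i.
  pose q := \sum_(j < r) a 0 j *: 'X^j : {poly K}.
  have coefq (i : 'I_r) : (to_poly (u - of_poly q))`_i = (to_poly u)`_i - a 0 i.
    rewrite raddfB /= of_polyK coefB; congr (_ - _); rewrite coef_sum.
    rewrite (bigD1 i) //= coefZ coefXn eqxx mulr1 big1 ?addr0 // => j ne_ji.
    by rewrite coefZ coefXn eq_sym (inj_eq val_inj) (negPf ne_ji) mulr0.
  split=> [uE|ua].
    have := etrans uE (irr_xpow_comb a).
    move/(modpi_eqE _ _ _).1.
    rewrite -(largest_max_submodule high_submod_largest).
    move/high_submodP => uJ i.
    by apply/subr0_eq; rewrite -coefq; apply: uJ.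
  refine (etrans _ (esym (irr_xpow_comb a))).
  apply/modpi_eqE; rewrite -(largest_max_submodule high_submod_largest).
  apply/high_submodP => i lt_ir.
  by rewrite (coefq (Ordinal lt_ir)) -ua subrr.
elim/modpi_ind => u; exists (\row_i (to_poly u)`_i); split.
  by apply/eq_comb => i; rewrite mxE.
by move=> a /eq_comb ua; apply/rowP => i; rewrite mxE ua.
Qed.

Lemma irr_space_dim : has_dim (irr_space m lam c) r.
Proof. exact: is_basis_has_dim irr_xpow_basis. Qed.

End FirstFixed.

(** * Which values of r occur *)

Lemma first_fixed_exists r : (0 < r)%N -> ~~ (m %| r)%N ->
  exists c' : nat -> K, first_fixed m lam c' r.
Proof.
move=> r_gt0 m_r; have m_gt0 := prim_order_gt0 lam_prim.
have natr_eq0 := (pcharf0P K).1 charK.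
have m_n0 : m%:R != 0 :> K by rewrite natr_eq0 -lt0n.
have lam_n0 := lam_neq0 lam_prim.
(* Inverse Fourier transform of the sequence equal to r at n = r mod m and    *)
(* to 0 elsewhere.                                                            *)
pose c' j : K := - (r%:R / (2%:R * m%:R)) * (1 - lam ^+ j) * lam ^- (j * r).
have bE n : bcoef m lam c' n = if (n == r %[mod m])%N then r%:R else 0.
  (* [k] stands for -r modulo m and keeps all exponents natural. *)
  have [k rk] : exists k, (m %| r + k)%N.
    by exists (r * m.-1)%N; rewrite -mulnS prednK // dvdn_mull.
  have lamV j : lam ^- (j * r) = lam ^+ (j * k).
    apply: (mulfI (expf_neq0 (j * r) lam_n0)).
    rewrite mulfV ?expf_neq0 // -exprD -mulnDr; apply/esym/eqP.
    by rewrite -(prim_order_dvd lam_prim) dvdn_mull.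
  (* The terms j = 0 of the two sums cancel, so both may run over all of Z/m. *)
  have -> : bcoef m lam c' n =
      r%:R / m%:R * (\sum_(j < m) lam ^+ (j * (n + k)) - \sum_(j < m) lam ^+ (j * k)).
    rewrite -sumrB /bcoef.
    rewrite -(big_mkord xpredT (fun j => lam ^+ (j * (n + k)) - lam ^+ (j * k))).
    rewrite (big_ltn m_gt0) !mul0n subrr add0r !mulr_sumr.
    apply: eq_big_nat => j j_m; have := prim_expr_neq1 lam_prim j_m.
    rewrite /c' lamV mulnDr exprD => nz.
    have two_n0 : 2%:R != 0 :> K by rewrite natr_eq0.
    by field; rewrite nz m_n0 two_n0.
  rewrite !(sum_prim_expr lam_prim).
  (* As m does not divide r, the second sum vanishes. *)
  have -> : (m %| k)%N = false.
    apply/negP => m_k; case/negP: m_r.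
    by rewrite -(dvdn_addl _ m_k).
  have -> : (m %| n + k)%N = (n == r %[mod m])%N.
    by move: rk; rewrite -(eqn_modDr k) /dvdn => /eqP ->.
  by case: ifP => _; rewrite ?mul1r !mul0r subr0 ?mulr0 // divfK.
(* For 0 < n < r, b_n is r or 0, and neither equals n. *)
exists c'; split; rewrite ?bE ?eqxx // => n /andP[n_gt0 lt_nr].
rewrite bE; case: ifP => _; apply/eqP; last by rewrite natr_eq0 -lt0n.
by rewrite eqr_nat_pchar0 // ltn_eqF.
Qed.

(** At multiples of m the number b_r is 0, whereas r is nonzero in characteristic 0. *)
Lemma first_fixed_ndvd r : first_fixed m lam c r -> ~~ (m %| r)%N.
Proof.
case=> r_gt0 rE _; apply/negP => m_r; have natr_eq0 := (pcharf0P K).1 charK.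
by move/eqP: rE; rewrite (bcoef_dvd lam_prim) // natr_eq0 gtn_eqF.
Qed.

End MainResults.

Theorem proposition3p40 (R : realType) (m : nat) (lam : R[i])
    (hm : (2 <= m)%N) (hlam : m.-primitive_root lam) :
  (forall c : nat -> R[i],
     (irreducible_module (std_module m lam c) <->
        forall n : nat, (1 <= n)%N -> n%:R - bcoef m lam c n != 0)
     /\
     (forall r : nat, first_fixed m lam c r ->
        has_dim (irr_space m lam c) r /\
        is_basis (fun i : 'I_r => irr_xpow m lam c i)))
  /\
  (forall r : nat, (0 < r)%N ->
     ((exists c : nat -> R[i], first_fixed m lam c r) <-> ~~ (m %| r)%N)).
Proof.
have charC : [pchar R[i]] =i pred0 by exact: Num.Theory.pchar_num.
split=> [c|r r_gt0].
  split; first exact: std_module_irreducible.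
  by move=> r r_first; split; [apply: irr_space_dim | apply: irr_xpow_basis].
split=> [[c]|]; first exact: first_fixed_ndvd.
exact: first_fixed_exists.
Qed.
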